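(* Let $\lambda$ be a nonzero integer partition, let $n = h_\lambda(1,1)+1$, and let $c \in \mathfrak{S}_n$ be a Coxeter element. Then the map $\operatorname{RSK}_{\lambda,c}$ is a bijection from the set of fillings of shape $\lambda$ onto the set of reverse plane partitions of shape $\lambda$. (In particular, for every filling $f$ of shape $\lambda$, $\operatorname{RSK}_{\lambda,c}(f)$ is a reverse plane partition.)
   Context: Integer partitions: an integer partition is a weakly decreasing sequence $\lambda=(\lambda_k)_{k\ge 1}$ of nonnegative integers with finitely many nonzero terms. Its Ferrers diagram is $\operatorname{Fer}(\lambda)=\{(i,j)\in(\mathbb{N}^* )^2 : j \le \lambda_i\}$ ($i$ = row index, $j$ = column index). $\unlhd$ denotes the componentwise (product) order on $(\mathbb{N}^* )^2$. A filling of shape $\lambda$ is any map $f:\operatorname{Fer}(\lambda)\to\mathbb{N}$; it is a reverse plane partition if it is weakly increasing with respect to $\unlhd$. The hook length of the box $(1,1)$ is $h_\lambda(1,1)=\#\{(i,j)\in\operatorname{Fer}(\lambda): i=1 \text{ or } j=1\}$. For $m\in\mathbb{Z}$, the $m$-th diagonal is $D_m(\lambda)=\{(i,j)\in\operatorname{Fer}(\lambda): i-j+\lambda_1=m\}$; it is nonempty for $1\le m\le h_\lambda(1,1)$, and $(u_m,v_m)$ denotes its $\unlhd$-maximal element. Greene–Kleitman invariants: for a finite directed acyclic graph $G$ without multiple arrows and a map $f:G_0\to\mathbb{N}$ on its vertices, a path is a sequence of vertices $(v_0,\dots,v_k)$, $k\ge0$, with each $(v_t,v_{t+1})$ an arrow;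 its support is its set of vertices. For $\ell\ge1$ let $\Pi_\ell(G)$ be the set of $\ell$-tuples of paths, the support of a tuple being the union of the supports, and $\mathrm{wt}_f(\underline\gamma)=\sum_{v\in\operatorname{Supp}(\underline\gamma)}f(v)$. Put $M_0=0$, $M_\ell=\max_{\underline\gamma\in\Pi_\ell(G)}\mathrm{wt}_f(\underline\gamma)$, and $\operatorname{GK}_G(f)=(M_\ell-M_{\ell-1})_{\ell\ge1}$ (an integer partition). Interval bipartitions: an interval bipartition is a pair $(\mathbf B,\mathbf E)$ of subsets of $\mathbb{N}^*$ forming a set partition of an interval $\{i,\dots,j\}$; it is elementary if $1\in\mathbf B$ and $\max(\mathbf B\cup\mathbf E)\in\mathbf E$. For $\mathbf B=\{b_1<\dots<b_p\}$, $\mathbf E=\{e_1<\dots<e_q\}$, define $\lambda(\mathbf B,\mathbf E)_i=\#\{e\in\mathbf E: b_i<e\}$ for $i\le p$ and $0$ for $i>p$; thus $(i,j)\in\operatorname{Fer}(\lambda(\mathbf B,\mathbf E))$ iff $b_i<e_{q-j+1}$. For a nonzero $\lambda$ there is a unique elementary interval bipartition $(\mathbf B,\mathbf E)$ with $\lambda(\mathbf B,\mathbf E)=\lambda$; it partitions $\{1,\dots,n\}$ with $n=h_\lambda(1,1)+1$. Coxeter elements and AR quivers: permutations compose right to left; $s_i=(i,i+1)$. A Coxeter element of $\mathfrak{S}_n$ is a product of all of $s_1,\dots,s_{n-1}$, each exactly once, in some order. For a Coxeter element $c$, the Auslander–Reiten quiver $\operatorname{AR}(c)$ is the directed graph whose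 vertices are the transpositions $(i,j)$ with $1\le i<j\le n$, with arrows $(i,j)\to(i,c(j))$ whenever $i<c(j)$, and $(i,j)\to(c(i),j)$ whenever $c(i)<j$. For $1\le m\le n-1$, $\operatorname{AR}_m(c)$ is the full subgraph of $\operatorname{AR}(c)$ on the vertices $(i,j)$ with $i\le m<j$. The map $\operatorname{RSK}_{\lambda,c}$: let $(\mathbf B,\mathbf E)$ (with $\mathbf B=\{b_1<\dots<b_p\}$, $\mathbf E=\{e_1<\dots<e_q\}$) be the elementary interval bipartition with $\lambda(\mathbf B,\mathbf E)=\lambda$. For a filling $f$ of shape $\lambda$, define $\overline f$ on the vertices of $\operatorname{AR}(c)$ by $\overline f(b_i,e_{q-j+1})=f(i,j)$ for $(i,j)\in\operatorname{Fer}(\lambda)$ and $\overline f(x,y)=0$ for all other transpositions. Then $g=\operatorname{RSK}_{\lambda,c}(f)$ is the filling of shape $\lambda$ given, for each $m\in\{1,\dots,n-1\}$ and each $(i,j)\in D_m(\lambda)$, by $g(i,j)=\operatorname{GK}_{\operatorname{AR}_m(c)}(\overline f|_{\operatorname{AR}_m(c)})_{u_m-i+1}$. *)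

(* Defs.v *)
From Stdlib Require Import ClassicalEpsilon.
From mathcomp Require Import all_boot all_fingroup.
Set Implicit Arguments. Unset Strict Implicit. Unset Printing Implicit Defensive.

(* A partition is a weakly decreasing seq of naturals (trailing zeros allowed);
   lam_ lam i is lambda_i (rows are 1-indexed, lam_ lam i = 0 beyond the seq). *)
Definition is_partition (lam : seq nat) : Prop := sorted geq lam.
Definition part_nonzero (lam : seq nat) : Prop := has (fun x => 0 < x) lam.
Definition lam_ (lam : seq nat) (i : nat) : nat := nth 0 lam i.-1.
Definition same_partition (l1 l2 : seq nat) : Prop := forall i, nth 0 l1 i = nth 0 l2 i.

Definition in_fer (lam : seq nat) (p : nat * nat) : bool :=
  [&& 0 < p.1, 0 < p.2 & p.2 <= lam_ lam p.1].
Definition fer_seq (lam : seq nat) : seq (nat * nat) :=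
  [seq (i, j) | i <- iota 1 (size lam), j <- iota 1 (lam_ lam i)].
Definition hook11 (lam : seq nat) : nat :=
  count (fun p : nat * nat => (p.1 == 1) || (p.2 == 1)) (fer_seq lam).

Definition box (lam : seq nat) := {p : nat * nat | in_fer lam p}.
Definition filling (lam : seq nat) := box lam -> nat.
Definition boxle (p q : nat * nat) : bool := (p.1 <= q.1) && (p.2 <= q.2).
Definition is_rpp (lam : seq nat) (g : filling lam) : Prop :=
  forall p q : box lam, boxle (val p) (val q) -> g p <= g q.

(* diagonal index m of a box: i - j + lambda_1 (j <= lambda_1 for boxes) *)
Definition diag (lam : seq nat) (p : nat * nat) : nat := p.1 + lam_ lam 1 - p.2.
(* u_m: row index of the maximal element of D_m (a chain, ordered by row) *)
Definition umax (lam : seq nat) (m : nat) : nat :=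
  \max_(p <- fer_seq lam | diag lam p == m) p.1.

Definition interval_bipartition (B E : seq nat) : Prop :=
  [/\ sorted ltn B, sorted ltn E &
      exists i j, [/\ 0 < i, i <= j & perm_eq (B ++ E) (iota i (j.+1 - i))]].
Definition elementary (B E : seq nat) : Prop :=
  1 \in B /\ \max_(x <- B ++ E) x \in E.
Definition lamBE (B E : seq nat) : seq nat :=
  [seq count (fun e => b < e) E | b <- B].

(* S_n is {perm 'I_n} acting on {0..n-1}; permapp c k is the action on {1..n}. *)
Definition permapp n (c : {perm 'I_n}) (k : nat) : nat :=
  if k is k'.+1 then
    (if (insub k' : option 'I_n) is Some x then (val (c x)).+1 else k)
  else k.
(* s_i = (i, i+1) on {1..n}, i.e. tperm (i-1) i on 'I_n *)
Definition sgen n (i : nat) : {perm 'I_n} :=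
  match (insub i.-1 : option 'I_n), (insub i : option 'I_n) with
  | Some a, Some b => tperm a b
  | _, _ => 1%g
  end.
Definition coxeter n (c : {perm 'I_n}) : Prop :=
  exists o : seq nat, perm_eq o (iota 1 n.-1) /\ c = (\prod_(i <- o) sgen n i)%g.

Definition ar_vertices (n : nat) : seq (nat * nat) :=
  [seq p <- [seq (i, j) | i <- iota 1 n, j <- iota 1 n] | p.1 < p.2].
Definition ar_edge n (c : {perm 'I_n}) : rel (nat * nat) := fun u v =>
  [&& v.1 == u.1, v.2 == permapp c u.2 & u.1 < permapp c u.2] ||
  [&& v.2 == u.2, v.1 == permapp c u.1 & permapp c u.1 < u.2].
Definition ar_m (n m : nat) : seq (nat * nat) :=
  [seq v <- ar_vertices n | (v.1 <= m) && (m < v.2)].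

Definition is_path_in (T : eqType) (vs : seq T) (e : rel T) (p : seq T) : bool :=
  if p is x :: p' then all (fun y => y \in vs) p && path e x p' else false.
Definition tuple_wt (T : eqType) (vs : seq T) (w : T -> nat) (gs : seq (seq T)) : nat :=
  \sum_(v <- undup vs | has (fun p => v \in p) gs) w v.
Definition is_max_wt (T : eqType) (vs : seq T) (e : rel T) (w : T -> nat)
    (l m : nat) : Prop :=
  (exists gs, [/\ size gs = l, all (is_path_in vs e) gs & tuple_wt vs w gs = m]) /\
  (forall gs, size gs = l -> all (is_path_in vs e) gs -> tuple_wt vs w gs <= m).
Definition GK_M (T : eqType) (vs : seq T) (e : rel T) (w : T -> nat) (l : nat) : nat :=
  if l is 0 then 0 else epsilon (inhabits 0) (is_max_wt vs e w l).
(* GK_G(w)_l for l >= 1 *)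
Definition GK (T : eqType) (vs : seq T) (e : rel T) (w : T -> nat) (l : nat) : nat :=
  GK_M vs e w l - GK_M vs e w l.-1.

(* fbar (b_i, e_{q-j+1}) = f (i,j) for (i,j) in Fer(lam), 0 elsewhere *)
Definition fbar (lam : seq nat) (B E : seq nat) (f : filling lam) (v : nat * nat) : nat :=
  if (v.1 \in B) && (v.2 \in E) then
    (if (insub ((index v.1 B).+1, size E - index v.2 E) : option (box lam))
       is Some bx then f bx else 0)
  else 0.

Definition rsk (lam : seq nat) n (c : {perm 'I_n}) (B E : seq nat)
    (f : filling lam) : filling lam :=
  fun bx =>
    let m := diag lam (val bx) in
    GK (ar_m n m) (ar_edge c) (fbar B E f) (umax lam m - (val bx).1 + 1).

(* Main.v *)
(* Cutting the cycle c between {1..m} and {m+1..n} turns both halves into chains, so that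
   AR_m(c) is a grid: passing from m to m+1 adds the row m+1 at one end of the first chain,
   or removes the column m+1 at one end of the second one, the end being dictated by the
   position of m+1 on the unimodal cycle c. Hence the partitions GK_m, m = 0..n, interlace,
   and such interlacing sequences are the reverse plane partitions of shape lambda read
   along diagonals.

   For bijectivity, encode (B, E, c) as a word in letters B/E, each with a sign (the end).
   Exchanging two consecutive B's of opposite signs changes a single partition of the
   sequence, by a piecewise linear toggle; exchanging consecutive B, E of opposite signs
   removes a corner box from lambda, and the RSK local rule recovers its entry. The sign of
   the first B is immaterial, so its run can always be arranged to end with the sign
   opposite to that of the next E, and one concludes by induction on the number of boxes.

   Toggle and local rule both come from the tropical Desnanot-Jacobi identity
     M_k(R+r) + M_k(r'+R) = max (M_k(r'+R+r) + M_k(R), M_(k+1)(r'+R+r) + M_(k-1)(R)),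
   where M_k is the largest weight of a union of k chains and r', r are the first and last
   rows. It holds because M_k is the degree of a minor, with nonnegative coefficients, of a
   product of transfer matrices. *)
From Stdlib Require Import ClassicalEpsilon FunctionalExtensionality.
Require Import Defs.
From mathcomp Require Import all_boot all_order all_fingroup all_algebra zify.
Set Implicit Arguments. Unset Strict Implicit. Unset Printing Implicit Defensive.

(** * Greene-Kleitman invariants of a weighted grid *)

(** The largest weight of a union of k chains is taken in dual form, over the subsets that contain
    no antichain of more than k elements. This form passes through relabellings and zero padding at
    no cost. Chains are produced only when needed, as level lines of the function that measures the
    largest antichain inside a quadrant. These level lines serve twice, for the disjoint lattice
    paths behind the minors and for the paths of the quiver.

    A polynomial identity gives a max-plus identity only if no leading term cancels. Hence the
    subtraction in Desnanot-Jacobi is moved to the other side, and the minors are expanded one grid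
    column at a time by a subtraction-free recursion instead of a sign-reversing involution on path
    families. Moreover the degree of a minor measures M_k only if k disjoint paths fit into the
    grid, so small grids are padded with zeros. *)

Definition antichain (T : finType) (cmp : rel T) (V : {set T}) : bool :=
  [forall x in V, forall y in V, cmp x y ==> (x == y)].
Definition width_le (T : finType) (cmp : rel T) (k : nat) (U : {set T}) : bool :=
  [forall V : {set T}, (V \subset U) && antichain cmp V ==> (#|V| <= k)].
Definition gkmax (T : finType) (cmp : rel T) (w : T -> nat) (k : nat) : nat :=
  \max_(U : {set T} | width_le cmp k U) \sum_(x in U) w x.

Lemma antichainP (T : finType) (cmp : rel T) (V : {set T}) :
  reflect {in V &, forall x y, cmp x y -> x = y} (antichain cmp V).
Proof.
apply: (iffP forall_inP) => [H x y xV yV cxy|H x xV].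
  by apply/eqP; move/forall_inP: (H x xV) => /(_ y yV) /implyP; apply.
by apply/forall_inP => y yV; apply/implyP => cxy; apply/eqP; apply: H.
Qed.

Lemma width_leP (T : finType) (cmp : rel T) k (U : {set T}) :
  reflect (forall V : {set T}, V \subset U -> antichain cmp V -> #|V| <= k)
          (width_le cmp k U).
Proof.
apply: (iffP forallP) => [H V sVU aV|H V].
  by have /implyP := H V; rewrite sVU aV; apply.
by apply/implyP => /andP[sVU aV]; apply: H.
Qed.

Lemma gkmax_ge (T : finType) (cmp : rel T) w k (U : {set T}) :
  width_le cmp k U -> \sum_(x in U) w x <= gkmax cmp w k.
Proof. by move=> wU; rewrite /gkmax (bigD1 U) //= leq_maxl. Qed.

Lemma width_le0 (T : finType) (cmp : rel T) k : width_le cmp k set0.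
Proof. by apply/width_leP => V; rewrite subset0 => /eqP-> _; rewrite cards0. Qed.

Lemma gkmax_ex (T : finType) (cmp : rel T) w k :
  exists2 U : {set T}, width_le cmp k U & gkmax cmp w k = \sum_(x in U) w x.
Proof.
rewrite /gkmax.
case: (@eq_bigmax_cond _ (fun U : {set T} => width_le cmp k U)
         (fun U => \sum_(x in U) w x)); last by move=> U wU ->; exists U.
by apply/card_gt0P; exists set0; rewrite unfold_in width_le0.
Qed.

Lemma gkmax_mono (T : finType) (cmp : rel T) w k l :
  k <= l -> gkmax cmp w k <= gkmax cmp w l.
Proof.
move=> kl; have [U wU ->] := gkmax_ex cmp w k; apply: gkmax_ge.
by apply/width_leP => V sV aV; apply: leq_trans kl; apply: (width_leP _ _ _ wU).
Qed.

Lemma gkmax_0 (T : finType) (cmp : rel T) w : reflexive cmp -> gkmax cmp w 0 = 0.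
Proof.
move=> rc; have [U wU ->] := gkmax_ex cmp w 0.
rewrite big1 // => x xU; suff: #|[set x]| <= 0 by rewrite cards1.
apply: (width_leP _ _ _ wU); first by rewrite sub1set.
by apply/antichainP => y z; rewrite !inE => /eqP-> /eqP->.
Qed.

(** Since [w'] vanishes off the image, a set and its preimage have the same weight. Transposition,
    half-turn, and insertion or deletion of zero rows and columns are all instances. *)
Lemma gkmax_emb (T T' : finType) (cmp : rel T) (cmp' : rel T') w w' (h : T -> T') k :
  injective h -> (forall x y, cmp' (h x) (h y) = cmp x y) ->
  (forall x, w' (h x) = w x) -> (forall y, y \notin codom h -> w' y = 0) ->
  gkmax cmp w k = gkmax cmp' w' k.
Proof.
move=> hI hc hw hw0; apply/eqP; rewrite eqn_leq; apply/andP; split.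
  have [U wU ->] := gkmax_ex cmp w k.
  have -> : \sum_(x in U) w x = \sum_(y in h @: U) w' y.
    by rewrite big_imset /=; [apply: eq_bigr => x _; rewrite hw | move=> x y _ _; apply: hI].
  apply: gkmax_ge; apply/width_leP => V sV aV.
  have -> : V = h @: (h @^-1: V).
    apply/setP => y; apply/idP/imsetP => [yV|[x + ->]]; last by rewrite inE.
    by have /imsetP[x xU yE] := subsetP sV y yV; exists x => //; rewrite inE -yE.
  rewrite card_imset //; apply: (width_leP _ _ _ wU).
    apply/subsetP => x; rewrite inE => /(subsetP sV) /imsetP[x' x'U /hI ->] //.
  apply/antichainP => x y; rewrite !inE => xV yV cxy; apply: hI.
  by apply: (antichainP _ _ aV) => //; rewrite hc.
have [U wU ->] := gkmax_ex cmp' w' k.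
have -> : \sum_(y in U) w' y = \sum_(x in h @^-1: U) w x.
  rewrite (bigID (fun y => y \in codom h)) /= [X in _ + X]big1 ?addn0; last first.
    by move=> y /andP[_ /hw0].
  rewrite (eq_bigl (fun y => y \in h @: (h @^-1: U))); last first.
    move=> y; apply/andP/imsetP => [[yU /codomP[x yE]]|[x + ->]].
      by exists x => //; rewrite inE -yE.
    by rewrite inE => ->; rewrite codom_f.
  by rewrite big_imset /=; [apply: eq_bigr => x _; rewrite hw | move=> x y _ _; apply: hI].
apply: gkmax_ge; apply/width_leP => V sV aV.
rewrite -(card_imset _ hI); apply: (width_leP _ _ _ wU).
  by apply/subsetP => y /imsetP[x xV ->]; move/subsetP: sV => /(_ x xV); rewrite inE.
apply/antichainP => _ _ /imsetP[x xV ->] /imsetP[y yV ->]; rewrite hc => cxy.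
by congr h; apply: (antichainP _ _ aV).
Qed.

Definition gridcmp p q : rel ('I_p * 'I_q) := fun u v =>
  ((u.1 <= v.1) && (u.2 <= v.2)) || ((v.1 <= u.1) && (v.2 <= u.2)).
Definition gkgrid (k p q : nat) (A : nat -> nat -> nat) : nat :=
  gkmax (@gridcmp p q) (fun x => A x.1 x.2) k.

Lemma gridcmp_refl p q : reflexive (@gridcmp p q).
Proof. by move=> x; rewrite /gridcmp !leqnn. Qed.

Lemma gkgrid0 p q A : gkgrid 0 p q A = 0.
Proof. exact/gkmax_0/gridcmp_refl. Qed.

Lemma gkgrid_mono k l p q A : k <= l -> gkgrid k p q A <= gkgrid l p q A.
Proof. exact: gkmax_mono. Qed.

Lemma eq_gkgrid k p q A A' :
  (forall i j, i < p -> j < q -> A i j = A' i j) -> gkgrid k p q A = gkgrid k p q A'.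
Proof.
move=> eqA; rewrite /gkgrid; apply: (gkmax_emb (h := id)) => // [x|y]; first by rewrite eqA.
by move/codomP; case; exists y.
Qed.

Lemma gkgrid_tr k p q A : gkgrid k p q A = gkgrid k q p (fun i j => A j i).
Proof.
rewrite /gkgrid; apply: (gkmax_emb (h := fun x : 'I_p * 'I_q => (x.2, x.1))) => //.
- by move=> [? ?] [? ?] /= [-> ->].
- by move=> x y; rewrite /gridcmp /= andbC [X in _ || X]andbC.
- by move=> [a b] /codomP; case; exists (b, a).
Qed.

Lemma gkgrid_rev k p q A :
  gkgrid k p q A = gkgrid k p q (fun i j => A (p - i.+1) (q - j.+1)).
Proof.
rewrite /gkgrid; apply: (gkmax_emb (h := fun x : 'I_p * 'I_q => (rev_ord x.1, rev_ord x.2))).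
- by move=> [? ?] [? ?] /= [] e1 e2; congr (_, _); apply: rev_ord_inj; apply: val_inj.
- have E n a b : a < n -> b < n -> (n - a.+1 <= n - b.+1) = (b <= a) by lia.
  by move=> [a b] [c d]; rewrite /gridcmp /= !E // orbC.
- have E n a : a < n -> n - (n - a.+1).+1 = a by lia.
  by move=> [a b] /=; rewrite !E.
- by move=> [a b] /codomP; case; exists (rev_ord a, rev_ord b); rewrite /= !rev_ordK.
Qed.

Lemma gkgrid_emb k p q p' q' A A' (hr hc : nat -> nat) :
  (forall i, i < p -> hr i < p') -> (forall j, j < q -> hc j < q') ->
  {in gtn p &, {mono hr : i j / i <= j}} -> {in gtn q &, {mono hc : i j / i <= j}} ->
  (forall i j, i < p -> j < q -> A' (hr i) (hc j) = A i j) ->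
  (forall i j, i < p' -> j < q' ->
     ~ (exists i0 j0, [/\ i0 < p, j0 < q, i = hr i0 & j = hc j0]) -> A' i j = 0) ->
  gkgrid k p q A = gkgrid k p' q' A'.
Proof.
move=> br bc mr mc eA zA.
pose h (x : 'I_p * 'I_q) := (Ordinal (br _ (ltn_ord x.1)), Ordinal (bc _ (ltn_ord x.2))).
rewrite /gkgrid; have Er (x y : 'I_p) : (hr x <= hr y) = (x <= y) by apply: mr; apply: ltn_ord.
have Ec (x y : 'I_q) : (hc x <= hc y) = (x <= y) by apply: mc; apply: ltn_ord.
apply: (gkmax_emb (h := h)) => [[i j] [i' j']|[i j] [i' j']|[i j]|[i j] nh] /=.
- move=> [] ei ej; congr (_, _); apply/val_inj/eqP; rewrite /= eqn_leq.
    by rewrite -(Er i i') -(Er i' i) ei leqnn.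
  by rewrite -(Ec j j') -(Ec j' j) ej leqnn.
- by rewrite /gridcmp /= (Er i i') (Er i' i) (Ec j j') (Ec j' j).
- by rewrite eA.
- apply: zA => // -[i0 [j0 [Hi Hj ei ej]]]; move/codomP: nh; case.
  by exists (Ordinal Hi, Ordinal Hj); congr (_, _); apply: val_inj.
Qed.

(** * Disjoint lattice paths and minors *)

Section Minors.
Import Order.TTheory GRing.Theory Num.Theory.
Local Open Scope ring_scope.

(** Cauchy-Binet in unsorted form, from multilinearity in the columns alone: the sum runs over all
    maps [K]. In [pdetS] the interlacing coefficients kill the maps that are not increasing. *)
Lemma det_col_sum (R : comNzRingType) k N (M : 'I_k -> 'I_N -> R) (C : 'I_N -> 'I_k -> R) :
  \det (\matrix_(i < k, r < k) \sum_(l < N) M i l * C l r) =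
  \sum_(K : {ffun 'I_k -> 'I_N})
     (\prod_r C (K r) r) * \det (\matrix_(i < k, r < k) M i (K r)).
Proof.
have detE (A : 'M[R]_k) : \det A = \sum_(s : 'S_k) (-1) ^+ s * \prod_i A (s i) i.
  by rewrite -det_tr; apply: eq_bigr => s _; under eq_bigr do rewrite mxE.
rewrite detE.
under eq_bigr => s _.
  under eq_bigr => i _ do rewrite mxE.
  rewrite bigA_distr_bigA /= big_distrr /=.
  over.
rewrite exchange_big /=; apply: eq_bigr => K _.
rewrite detE big_distrr /=; apply: eq_bigr => s _.
rewrite big_split /= mulrA mulrC; congr (_ * (_ * _)).
by apply: eq_bigr => i _; rewrite mxE.
Qed.

Definition nnpoly (p : {poly int}) : Prop := forall i, 0 <= p`_i.

Lemma nnpoly0 : nnpoly 0.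
Proof. by move=> i; rewrite coef0. Qed.

Lemma nnpolyXn n : nnpoly 'X^n.
Proof. by move=> i; rewrite coefXn ler0n. Qed.

Lemma nnpolyD p q : nnpoly p -> nnpoly q -> nnpoly (p + q).
Proof. by move=> hp hq i; rewrite coefD addr_ge0. Qed.

Lemma nnpolyM p q : nnpoly p -> nnpoly q -> nnpoly (p * q).
Proof. by move=> hp hq i; rewrite coefM sumr_ge0 // => j _; rewrite mulr_ge0. Qed.

Lemma nnpoly_sum (I : Type) (r : seq I) (P : pred I) (F : I -> {poly int}) :
  (forall j, P j -> nnpoly (F j)) -> nnpoly (\sum_(j <- r | P j) F j).
Proof. by move=> H; apply: big_ind => //; [apply: nnpoly0 | apply: nnpolyD]. Qed.

(** A positive leading coefficient cannot be cancelled by a nonnegative one. This is the passage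
    from sums of polynomials to maxima of degrees. *)
Lemma size_addl_nn (p q : {poly int}) :
  nnpoly p -> nnpoly q -> (size p <= size (p + q)%R)%N.
Proof.
move=> pp pq.
have [->|p0] := eqVneq p 0; first by rewrite size_poly0.
rewrite leqNgt; apply/negP => lt.
have : (p + q)`_(size p).-1 = 0.
  by apply: nth_default; rewrite -ltnS prednK ?size_poly_gt0.
have lp : lead_coef p != 0 by rewrite lead_coef_eq0.
rewrite coefD => /eqP; rewrite paddr_eq0 // => /andP[h _].
by rewrite /lead_coef h in lp.
Qed.

Lemma size_sum_nn (I : finType) (F : I -> {poly int}) (i : I) :
  (forall j, nnpoly (F j)) -> (size (F i) <= size (\sum_j F j)%R)%N.
Proof.
move=> H; rewrite (bigD1 i) //=; apply: size_addl_nn => //.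
exact: nnpoly_sum.
Qed.

Lemma size_add_nn (p q : {poly int}) :
  nnpoly p -> nnpoly q -> size (p + q)%R = maxn (size p) (size q).
Proof.
move=> pp pq; apply/eqP; rewrite eqn_leq size_polyD geq_max size_addl_nn //=.
by rewrite addrC size_addl_nn.
Qed.

(* [transfer A c i j] is the generating polynomial, by weight, of the lattice paths that
   enter column 0 in row [i] and leave column [c.-1] in row [j]. *)
Fixpoint transfer (A : nat -> nat -> nat) (c : nat) : nat -> nat -> {poly int} :=
  if c is c'.+1 then
    fun i j => \sum_(l < j.+1) transfer A c' i l * 'X^(\sum_(l <= x < j.+1) A x c')%N
  else fun i j => (i == j)%:R.

Definition pdet A c k (J : nat -> nat) :=
  \det (\matrix_(i < k, r < k) transfer A c i (J r)).

Lemma eq_pdet A c k J J' : (forall r, (r < k)%N -> J r = J' r) -> pdet A c k J = pdet A c k J'.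
Proof. by move=> e; congr (\det _); apply/matrixP => i r; rewrite !mxE e. Qed.

Lemma transfer_lt A c i j : (j < i)%N -> transfer A c i j = 0.
Proof.
elim: c j => [|c IH] j ji /=; first by rewrite gtn_eqF.
rewrite big1 // => l _; rewrite IH ?mul0r //; exact: leq_ltn_trans (leq_ord l) ji.
Qed.

Lemma transfer_shift A c i j :
  transfer A c i.+1 j.+1 = transfer (fun x => A x.+1) c i j.
Proof.
elim: c j => [|c IH] j /=; first by rewrite eqSS.
rewrite big_ord_recl /= transfer_lt // mul0r add0r.
apply: eq_bigr => l _; rewrite /bump /= add1n IH; congr (_ * 'X^_).
by rewrite big_add1.
Qed.

(** The least row in which path r may enter a column that path r-1 leaves in row [J r.-1]. The value
    0 leaves the first path free. *)
Definition lowrow (J : nat -> nat) (r : nat) : nat := if r is r'.+1 then (J r').+1 else 0%N.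

Definition natfun k N (K : {ffun 'I_k -> 'I_N}) (r : nat) : nat :=
  if insub r is Some r' then val (K r') else 0%N.

Lemma natfunE k N (K : {ffun 'I_k -> 'I_N}) (r : 'I_k) : natfun K r = K r.
Proof. by rewrite /natfun valK. Qed.

(* Subtracting a multiple of the previous column truncates the sum defining the
   column [J r] to the rows above [J r.-1], so the expansion has no signs. *)
Lemma pdetS A c k J N :
  (forall r, r.+1 < k -> J r < J r.+1)%N -> (forall r, r < k -> J r < N)%N ->
  pdet A c.+1 k J =
  \sum_(K : {ffun 'I_k -> 'I_N})
   (\prod_(r < k) (if (lowrow J r <= K r <= J r)%N then 'X^(\sum_(K r <= x < (J r).+1) A x c)%N
             else 0)) * pdet A c k (natfun K).
Proof.
move=> incJ ltJ.
pose T i r := \sum_(l < N) transfer A c i l *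
  (if (lowrow J r <= l <= J r)%N then 'X^(\sum_(l <= x < (J r).+1) A x c)%N else 0).
have eT i (r : nat) : (r < k)%N -> transfer A c.+1 i (J r) = T i r +
   (if r is r'.+1 then 'X^(\sum_((J r').+1 <= x < (J r).+1) A x c)%N * transfer A c.+1 i (J r')
    else 0).
  move=> rk /=; rewrite /T.
  have sumE (g : nat -> {poly int}) (h : nat -> nat) :
      \sum_(l < N) g l * (if (lowrow J r <= l <= J r)%N then 'X^(h l) else 0) =
      \sum_(lowrow J r <= l < (J r).+1) g l * 'X^(h l).
    rewrite (eq_bigr (fun l : 'I_N => if (lowrow J r <= l <= J r)%N then g l * 'X^(h l) else 0));
      last by move=> l _; case: ifP => _; rewrite ?mulr0.
    rewrite -big_mkcond /= -(big_mkord (fun l => lowrow J r <= l <= J r)%N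
       (fun l => g l * 'X^(h l))).
    rewrite [RHS](big_nat_widen _ _ N) ?ltJ //= [RHS](big_nat_widenl _ 0) //=.
    by apply: eq_bigl => l; rewrite ltnS andbC.
  rewrite (sumE _ (fun l => \sum_(l <= x < (J r).+1) A x c)%N).
  rewrite -(big_mkord xpredT (fun l => transfer A c i l * 'X^(\sum_(l <= x < (J r).+1) A x c)%N)).
  case: r rk {sumE} => [|r] rk /=; first by rewrite addr0.
  rewrite (big_cat_nat _ (n := (J r).+1)) //=; last by have := incJ _ rk; lia.
  rewrite addrC; congr (_ + _); rewrite big_distrr /= big_mkord; apply: eq_bigr => l _.
  rewrite mulrCA -exprD; congr (_ * 'X^_).
  rewrite addnC -big_cat_nat //=; last by have := incJ _ rk; lia.
  by have := ltn_ord l; lia.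
pose Y := \matrix_(i < k, r < k) transfer A c.+1 i (J r).
pose U : 'M[{poly int}]_k := \matrix_(s < k, r < k)
  (if s == r then 1 else if s.+1 == r then - 'X^(\sum_((J s).+1 <= x < (J r).+1) A x c)%N else 0).
have dU : \det U = 1.
  rewrite -det_tr det_trig ?big1 // => [i _|]; first by rewrite !mxE eqxx.
  apply/is_trig_mxP => i j ij; rewrite !mxE.
  by rewrite -val_eqE /= !gtn_eqF // (leq_trans ij).
have -> : pdet A c.+1 k J = \det (\matrix_(i < k, r < k) T i r).
  rewrite -[LHS]mulr1 -{}dU /pdet -/Y -det_mulmx; congr (\det _).
  apply/matrixP => i r; rewrite !mxE (bigD1 r) //= !mxE eqxx mulr1 eT //.
  case: r => -[|r] rk /=.
    rewrite addr0 big1 ?addr0 // => s sr; rewrite !mxE.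
    by rewrite (negbTE sr) /= mulr0.
  rewrite (bigD1 (Ordinal (ltnW rk))) ?mxE /=; last by rewrite -val_eqE /= ltn_eqF.
  rewrite -val_eqE /= ltn_eqF // eqxx [X in _ + (_ + X)]big1 ?addr0; last first.
    move=> s /andP[s1 s2]; rewrite !mxE (negbTE s1).
    by move: s2; rewrite -val_eqE /= eqSS => /negbTE ->; rewrite mulr0.
  by rewrite mulrN mulrC addrK.
rewrite /T (det_col_sum (fun i l => transfer A c i l) (fun l r => if (lowrow J r <= l <= J r)%N then 'X^(\sum_(l <= x < (J r).+1) A x c)%N else 0)).
apply: eq_bigr => K _; congr (_ * \det _); apply/matrixP => i r; rewrite !mxE.
by rewrite natfunE.
Qed.

Definition incr_on (k : nat) (J : nat -> nat) : Prop :=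
  forall r, (r.+1 < k -> J r < J r.+1)%N.

(* [Js d r] is the row in which the [r]-th of [k] disjoint lattice paths passes from
   column [d.-1] to column [d]. *)
Definition pathfam (k c : nat) (Js : nat -> nat -> nat) : Prop :=
  (forall r, r < k -> Js 0 r = r)%N /\
  forall d, (d < c)%N -> forall r, (r < k)%N ->
    (Js d r <= Js d.+1 r)%N /\ (r.+1 < k -> Js d.+1 r < Js d r.+1)%N.
Definition famweight (A : nat -> nat -> nat) k c (Js : nat -> nat -> nat) : nat :=
  (\sum_(d < c) \sum_(r < k) \sum_(Js d r <= x < (Js d.+1 r).+1) A x d)%N.

Lemma pathfam_incr k c Js d : pathfam k c Js -> (d <= c)%N -> incr_on k (Js d).
Proof.
move=> [H0 H] dc r rk; case: d dc => [|d] dc; first by rewrite !H0 // ltnW.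
have [_ /(_ rk) h1] := H d dc r (ltnW rk); have [h2 _] := H d dc _ rk.
exact: leq_trans h1 h2.
Qed.

Lemma incr_on_lb k J r : incr_on k J -> (r < k)%N -> (r <= J r)%N.
Proof. by move=> inc; elim: r => // r IH rk; apply: leq_ltn_trans (inc _ rk); apply/IH/ltnW. Qed.

Lemma pdet0_id A k J : (forall r, r < k -> J r = r)%N -> pdet A 0 k J = 1.
Proof.
move=> Jid; rewrite /pdet -(det1 _ k); congr (\det _); apply/matrixP => i r.
by rewrite !mxE /= Jid.
Qed.

(** The last column of the minor is zero if the last value of [J] is too large; otherwise a strictly
    increasing [J] has no room to differ from the identity. *)
Lemma pdet0_neq A k J : incr_on k J -> pdet A 0 k J != 0 -> forall r, (r < k)%N -> J r = r.
Proof.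
move=> inc; case: k inc => // k inc D0.
have Jk : (J k <= k)%N.
  rewrite leqNgt; apply: contra D0 => ltk; rewrite /pdet (expand_det_col _ ord_max).
  rewrite big1 // => i _; rewrite !mxE /= ltn_eqF ?mul0r //.
  exact: leq_trans (ltn_ord i) ltk.
have H s : (s <= k)%N -> (J (k - s) <= k - s)%N.
  elim: s => [|s IH] sk; first by rewrite subn0.
  have e : (k - s = (k - s.+1).+1)%N by lia.
  have := IH (ltnW sk); have := inc (k - s.+1)%N; rewrite -e ltnS leq_subr => /(_ isT); lia.
move=> r rk; apply/eqP; rewrite eqn_leq (incr_on_lb inc rk) andbT.
by have := H (k - r)%N; rewrite subKn ?leq_subr //; apply.
Qed.

Lemma pdetS_max A c k J : incr_on k J ->
  pdet A c.+1 k J =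
  \sum_(K : {ffun 'I_k -> 'I_(\max_(r < k) J r).+1})
   (\prod_(r < k) (if (lowrow J r <= K r <= J r)%N then 'X^(\sum_(K r <= x < (J r).+1) A x c)%N
             else 0)) * pdet A c k (natfun K).
Proof.
by move=> inc; apply: pdetS => // r rk; rewrite ltnS; apply: (bigop.leq_bigmax (Ordinal rk)).
Qed.

Lemma prod_condX k (P : pred 'I_k) (w : 'I_k -> nat) :
  \prod_(r < k) (if P r then 'X^(w r) else 0 : {poly int}) =
  if [forall r, P r] then 'X^(\sum_(r < k) w r)%N else 0.
Proof.
case: ifP => [/forallP H|/negbT].
  rewrite (eq_bigr (fun r => 'X^(w r))) => [|r _]; last by rewrite H.
  by elim/big_rec2: _ => [|r y1 y2 _ ->]; rewrite ?expr0 ?exprD.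
rewrite negb_forall => /existsP[r nP]; rewrite (bigD1 r) //= (negbTE nP) mul0r //.
Qed.

Lemma natfun_incr k N (K : {ffun 'I_k -> 'I_N}) J :
  [forall r : 'I_k, lowrow J r <= K r <= J r]%N -> incr_on k (natfun K).
Proof.
move=> /forallP H r rk.
have /andP[_ h1] := H (Ordinal (ltnW rk)); have /andP[h2 _] := H (Ordinal rk).
rewrite (natfunE K (Ordinal (ltnW rk))) (natfunE K (Ordinal rk)).
exact: leq_ltn_trans h1 h2.
Qed.

(** Every [K] with a nonzero coefficient interlaces with [J], hence is strictly increasing again,
    and the induction goes through column by column. *)
Lemma pdet_nn A c k J : incr_on k J -> nnpoly (pdet A c k J).
Proof.
elim: c J => [|c IH] J inc.
  have [->|/(pdet0_neq inc) /pdet0_id ->] := eqVneq (pdet A 0 k J) 0; first exact: nnpoly0.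
  exact: (nnpolyXn 0).
rewrite pdetS_max //; apply: nnpoly_sum => K _; rewrite prod_condX.
case: ifP => [/natfun_incr /IH h|_]; last by rewrite mul0r; apply: nnpoly0.
by apply: nnpolyM => //; apply: nnpolyXn.
Qed.

Lemma pdet_term_nn A c k J N (K : {ffun 'I_k -> 'I_N}) :
  nnpoly ((\prod_(r < k) (if (lowrow J r <= K r <= J r)%N
      then 'X^(\sum_(K r <= x < (J r).+1) A x c)%N else 0)) * pdet A c k (natfun K)).
Proof.
rewrite prod_condX; case: ifP => [/natfun_incr h|_]; last by rewrite mul0r; apply: nnpoly0.
by apply: nnpolyM; [apply: nnpolyXn | apply: pdet_nn].
Qed.

(** Without cancellation each path family bounds the degree from below: the term of the expansion
    picked here is the one given by the rows where the family enters the last column. *)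
Lemma size_pdet_ge A c k Js : pathfam k c Js ->
  (famweight A k c Js < size (pdet A c k (Js c)))%N.
Proof.
elim: c => [|c IH] fam.
  by rewrite /famweight big_ord0 pdet0_id ?size_poly1 //; case: fam.
have famc : pathfam k c Js by case: fam => h0 h; split => // d dc; apply: h; apply: ltnW.
have inc : incr_on k (Js c.+1) by apply: pathfam_incr fam _.
have [h0 h] := fam.
set N := (\max_(r < k) Js c.+1 r).+1.
have bK (r : 'I_k) : (Js c r < N)%N.
  by rewrite ltnS; have [le _] := h c (ltnSn c) r (ltn_ord r);
     apply: leq_trans le (bigop.leq_bigmax r).
pose K := [ffun r : 'I_k => Ordinal (bK r)].
rewrite pdetS_max //.
apply: leq_trans (size_sum_nn K _) => [|K']; last exact: pdet_term_nn.
rewrite prod_condX ifT; last first.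
  apply/forallP => r; rewrite ffunE /=; have [-> _] := h c (ltnSn c) r (ltn_ord r).
  rewrite andbT; case: r => -[|r] rk //=.
  by have [_ ->] := h c (ltnSn c) r (ltnW rk).
have eK : pdet A c k (natfun K) = pdet A c k (Js c).
  by apply: eq_pdet => r rk; rewrite (natfunE K (Ordinal rk)) ffunE.
have := IH famc; rewrite eK => lt.
have n0 : pdet A c k (Js c) != 0 by rewrite -size_poly_gt0; apply: leq_ltn_trans lt.
rewrite size_monicM ?monicXn // size_polyXn /= /famweight big_ord_recr /=.
rewrite addnC -addnS leq_add // leq_eqVlt; apply/orP; left; apply/eqP.
by apply: eq_bigr => r _; rewrite ffunE.
Qed.

(** Some term of the expansion attains the size of the whole sum; following such terms back through
    the columns traces a family of that weight. The successor is there because [size] is the degree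
    plus one. *)
Lemma size_pdet_le A c k J : incr_on k J -> pdet A c k J != 0 ->
  exists Js, [/\ pathfam k c Js, (forall r, r < k -> Js c r = J r)%N &
    size (pdet A c k J) = (famweight A k c Js).+1].
Proof.
elim: c J => [|c IH] J inc D0.
  have Jid := pdet0_neq inc D0; exists (fun _ => J); split => //.
  by rewrite /famweight big_ord0 pdet0_id ?size_poly1.
rewrite pdetS_max // in D0 *.
set F := fun K : {ffun 'I_k -> 'I_(\max_(r < k) J r).+1} =>
  (\prod_(r < k) (if (lowrow J r <= K r <= J r)%N
      then 'X^(\sum_(K r <= x < (J r).+1) A x c)%N else 0)) * pdet A c k (natfun K).
rewrite -/F -/(\sum_K F K) in D0 *.
have [K eK] : exists K, size (\sum_K F K) = size (F K).
  have [|K eK] := @bigop.eq_bigmax _ (fun K => size (F K)).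
    apply/card_gt0P; have [K0|none] := pickP (fun K => F K != 0); first by exists K0.
    by case/eqP: D0; rewrite big1 // => K _; apply/eqP/negbFE/none.
  exists K; apply/eqP; rewrite eqn_leq -{1}eK size_sum /=.
  by apply: size_sum_nn => K'; apply: pdet_term_nn.
have FK0 : F K != 0 by rewrite -size_poly_gt0 -eK size_poly_gt0.
rewrite eK {eK}; move: FK0; rewrite /F prod_condX; case: ifP => [HK|]; last by rewrite mul0r eqxx.
rewrite mulf_eq0 negb_or => /andP[_ D0'].
have [Js [fam JsK sz]] := IH _ (natfun_incr HK) D0'.
pose Js' d r := if (d <= c)%N then Js d r else J r.
have [h0 h] := fam.
have HJ r : (r < k)%N -> (lowrow J r <= Js c r <= J r)%N.
  by move=> rk; rewrite JsK // (natfunE K (Ordinal rk)); apply: (forallP HK (Ordinal rk)).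
exists Js'; split => [|r rk|].
- split => [r rk|d dc r rk]; first by rewrite /Js' h0.
  rewrite /Js'; have [->|{}dc] : d = c \/ (d < c)%N by move: dc; rewrite ltnS leq_eqVlt => /predU1P.
    rewrite leqnn ltnn; split; first by have /andP[] := HJ _ rk.
    by move=> rk'; have /andP[] := HJ _ rk'.
  by rewrite dc (ltnW dc); apply: h.
- by rewrite /Js' ltnn.
- rewrite size_monicM ?monicXn // size_polyXn sz /= addnS /famweight big_ord_recr /=.
  congr _.+1; rewrite addnC; congr (_ + _)%N.
    by apply: eq_bigr => d _; rewrite /Js' ltn_ord (ltnW (ltn_ord d)).
  by apply: eq_bigr => r _; rewrite /Js' leqnn ltnn JsK // natfunE.
Qed.

End Minors.

(** * Antichains in quadrants and their level lines *)

Definition layer p q (U : {set 'I_p * 'I_q}) (i c : nat) : nat :=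
  \max_(V : {set 'I_p * 'I_q} | [&& V \subset U, antichain (@gridcmp p q) V &
      [forall x in V, (x.1 < i) && (c <= x.2)]]) #|V|.

Lemma layer_ge p q (U V : {set 'I_p * 'I_q}) i c :
  V \subset U -> antichain (@gridcmp p q) V ->
  (forall x, x \in V -> (x.1 < i) && (c <= x.2)) -> #|V| <= layer U i c.
Proof.
move=> sV aV bV; rewrite /layer (bigD1 V) ?leq_maxl //= sV aV.
exact/forall_inP.
Qed.

Lemma layer_le p q (U : {set 'I_p * 'I_q}) i c m :
  (forall V : {set 'I_p * 'I_q}, V \subset U -> antichain (@gridcmp p q) V ->
    (forall x, x \in V -> (x.1 < i) && (c <= x.2)) -> #|V| <= m) -> layer U i c <= m.
Proof. by move=> H; apply/bigmax_leqP => V /and3P[? ? /forall_inP ?]; apply: H. Qed.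

Lemma antichainS (T : finType) (cmp : rel T) (V W : {set T}) :
  V \subset W -> antichain cmp W -> antichain cmp V.
Proof.
move=> sV /antichainP aW; apply/antichainP => x y xV yV; apply: aW; exact: (subsetP sV).
Qed.

Lemma layer_mono p q (U : {set 'I_p * 'I_q}) i i' c c' :
  i <= i' -> c' <= c -> layer U i c <= layer U i' c'.
Proof.
move=> ii cc; apply: layer_le => V sV aV bV; apply: layer_ge => // x /bV /andP[h1 h2].
by rewrite (leq_trans h1 ii) (leq_trans cc h2).
Qed.

Lemma layer_row p q (U : {set 'I_p * 'I_q}) i c : layer U i c <= i.
Proof.
apply: layer_le => V sV /antichainP aV bV.
have [V0|[x0 x0V]] := set_0Vmem V; first by rewrite V0 cards0.
case: i bV => [/(_ _ x0V)|i bV] //.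
rewrite -(card_in_imset (f := fun x : 'I_p * 'I_q => inord x.1 : 'I_i.+1)).
  by rewrite -[X in _ <= X]card_ord max_card.
move=> x y xV yV /(congr1 val) /=.
have /andP[hx _] := bV _ xV; have /andP[hy _] := bV _ yV.
rewrite !inordK // => e; apply: aV => //; rewrite /gridcmp e leqnn /=.
exact: leq_total.
Qed.

Lemma layer_col0 p q (U : {set 'I_p * 'I_q}) i c : q <= c -> layer U i c = 0.
Proof.
move=> qc; apply/eqP; rewrite -leqn0; apply: layer_le => V sV aV bV.
have [V0|[x0 /bV /andP[_]]] := set_0Vmem V; first by rewrite V0 cards0.
by rewrite leqNgt (leq_trans (ltn_ord _) qc).
Qed.

(** The last row and the first column of the quadrant form a hook, which is a chain, so an antichain
    meets it at most once. For level lines this says that consecutive ones are disjoint. *)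
Lemma layer_drop p q (U : {set 'I_p * 'I_q}) i c :
  layer U i.+1 c <= (layer U i c.+1).+1.
Proof.
apply: layer_le => V sV aV bV.
pose W := [set x in V | (x.1 == i :> nat) || (x.2 == c :> nat)].
have W1 : #|W| <= 1.
  apply/card_le1_eqP => x y; rewrite !inE => /andP[xV hx] /andP[yV hy].
  apply: (antichainP _ _ aV) => //; rewrite /gridcmp.
  have /andP[a1 a2] := bV _ xV; have /andP[b1 b2] := bV _ yV.
  move: hx hy a1 a2 b1 b2; move: (x.1 : nat) (x.2 : nat) (y.1 : nat) (y.2 : nat).
  by clear; lia.
have sWV : W \subset V by apply/subsetP => x; rewrite inE => /andP[].
rewrite -(cardsID W V) (setIidPr sWV) -add1n leq_add //.
apply: layer_ge; first exact: subset_trans (subsetDl _ _) sV.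
  exact: antichainS (subsetDl _ _) aV.
move=> x; rewrite !inE => /andP[h xV]; have /andP[h1 h2] := bV _ xV.
move: h h1 h2; rewrite xV /=; move: (x.1 : nat) (x.2 : nat).
by clear; lia.
Qed.

(** The cells in smaller rows and larger columns than [x] are incomparable with [x], so [x] extends
    every antichain among them. Consequently [x] lies on the level line numbered
    [layer U x.1 x.2.+1], and k level lines cover [U]. *)
Lemma layer_cover p q (U : {set 'I_p * 'I_q}) k x : x \in U ->
  width_le (@gridcmp p q) k U ->
  layer U x.1 x.2.+1 < k /\ layer U x.1 x.2.+1 < layer U x.1.+1 x.2.
Proof.
move=> xU /width_leP wU.
suff H m : (forall V : {set 'I_p * 'I_q}, V \subset U -> antichain (@gridcmp p q) V ->
    (forall y, y \in V -> (y.1 < x.1.+1) && (x.2 <= y.2)) -> #|V| <= m) -> layer U x.1 x.2.+1 < m.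
  split; apply: H => V sV aV bV; [exact: wU | exact: layer_ge].
move=> H; have m0 : 0 < m.
  rewrite -(cards1 x); apply: H; first by rewrite sub1set.
    by apply/antichainP => y z; rewrite !inE => /eqP-> /eqP->.
  by move=> y; rewrite inE => /eqP->; rewrite ltnSn leqnn.
rewrite -(prednK m0) ltnS; apply: layer_le => V sV aV bV.
have nx : x \notin V by apply/negP => /bV; rewrite ltnn.
suff: #|x |: V| <= m by rewrite cardsU1 nx; lia.
apply: H; first by rewrite subUset sub1set xU sV.
  have nc y : y \in V -> ~~ gridcmp x y.
    move=> /bV; rewrite /gridcmp; move: (x.1 : nat) (x.2 : nat) (y.1 : nat) (y.2 : nat).
    by clear; lia.
  apply/antichainP => y z; rewrite !inE => /predU1P[->|yV] /predU1P[->|zV] //.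
  - by move=> h; have := nc _ zV; rewrite h.
  - by move=> h; have := nc _ yV; rewrite /gridcmp orbC in h *; rewrite h.
  - exact: (antichainP _ _ aV).
move=> y; rewrite !inE => /predU1P[->|/bV /andP[h1 h2]]; first by rewrite ltnSn leqnn.
by rewrite ltnS (ltnW h1) ltnW.
Qed.

(** The row in which the r-th level line of the height function [H] enters column c; it is [P] if
    the height never exceeds r. *)
Definition level P (H : nat -> nat -> nat) c r : nat :=
  find (fun i => r < H i.+1 c) (iota 0 P).

Lemma level_le P H c r i : i < P -> {homo H^~ c : i j / i <= j} ->
  (level P H c r <= i) = (r < H i.+1 c).
Proof.
move=> iP mH; apply/idP/idP => [le|lt]; last first.
  rewrite leqNgt; apply/negP => /(before_find 0).
  by rewrite nth_iota // add0n lt.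
have hs : has (fun i => r < H i.+1 c) (iota 0 P).
  by rewrite has_find size_iota; apply: leq_ltn_trans iP.
have := nth_find 0 hs; rewrite nth_iota ?add0n -/(level P H c r); last first.
  exact: leq_ltn_trans iP.
by move=> h; apply: leq_trans h _; apply: mH.
Qed.

Lemma incr_on_lt k J r r' : incr_on k J -> r < r' -> r' < k -> J r < J r'.
Proof.
move=> inc; elim: r' => // r' IH; rewrite ltnS leq_eqVlt => /predU1P[->|lt] lk; first exact: inc.
by apply: leq_trans (inc _ lk); rewrite ltnS ltnW //; apply: IH => //; apply: ltnW.
Qed.

Lemma pathfam_mono k q Js d d' r :
  pathfam k q Js -> r < k -> d <= d' -> d' <= q -> Js d r <= Js d' r.
Proof.
move=> [_ H] rk; elim: d' => [|d' IH]; first by rewrite leqn0 => /eqP->.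
rewrite leq_eqVlt => /predU1P[->|lt] lq //.
by apply: leq_trans (IH lt (ltnW lq)) _; have [] := H d' lq r rk.
Qed.

Lemma famweightE A k p q Js : (forall d r, d <= q -> r < k -> Js d r < p) ->
  famweight A k q Js = \sum_(x : 'I_p * 'I_q)
    A x.1 x.2 * #|[set r : 'I_k | Js x.2 r <= x.1 <= Js x.2.+1 r]|.
Proof.
move=> bJ; rewrite -(pair_bigA _ (fun (i : 'I_p) (d : 'I_q) =>
    A i d * #|[set r : 'I_k | Js d r <= i <= Js d.+1 r]|)) /= exchange_big /=.
apply: eq_bigr => d _.
transitivity (\sum_(r < k) \sum_(i < p | Js d r <= i <= Js d.+1 r) A i d).
  apply: eq_bigr => r _; rewrite (big_nat_widen _ _ p) ?bJ //.
  rewrite (big_nat_widenl _ 0) // big_mkord.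
  by apply: eq_bigl => i; rewrite ltnS andbC.
rewrite (exchange_big_dep xpredT) //=; apply: eq_bigr => i _.
by rewrite sum_nat_const mulnC; congr (_ * _); apply: eq_card => r; rewrite !inE.
Qed.

(** Two cells of one path are comparable, so by pigeonhole k paths cover a set of width at most k.
    Disjointness of the paths ensures that no cell is counted twice. *)
Lemma famweight_le_gk A k p q Js : pathfam k q Js -> (forall d r, d <= q -> r < k -> Js d r < p) ->
  famweight A k q Js <= gkgrid k p q A.
Proof.
move=> fam bJ; rewrite (famweightE A bJ).
pose U := [set x : 'I_p * 'I_q | [exists r : 'I_k, Js x.2 r <= x.1 <= Js x.2.+1 r]].
apply: leq_trans (gkmax_ge (U := U) _ _); last first.
  apply/width_leP => V sV /antichainP aV.
  have [V0|[x0 x0V]] := set_0Vmem V; first by rewrite V0 cards0.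
  have ex x : x \in V -> exists r : 'I_k, Js x.2 r <= x.1 <= Js x.2.+1 r.
    by move=> /(subsetP sV); rewrite inE => /existsP.
  have [r0 _] := ex _ x0V.
  pose rho (x : 'I_p * 'I_q) := odflt r0 [pick r : 'I_k | Js x.2 r <= x.1 <= Js x.2.+1 r].
  have rhoP x : x \in V -> Js x.2 (rho x) <= x.1 <= Js x.2.+1 (rho x).
    move=> xV; rewrite /rho; case: pickP => [r|none] //=.
    by have [r] := ex _ xV; rewrite (none r).
  rewrite -(card_in_imset (f := rho)); first by rewrite -[X in _ <= X]card_ord max_card.
  have key x y : x \in V -> y \in V -> rho x = rho y -> x.2 < y.2 -> x = y.
    move=> xV yV e lt; apply: aV => //; rewrite /gridcmp (ltnW lt) andbT.
    have /andP[_ h1] := rhoP _ xV; have /andP[h2 _] := rhoP _ yV.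
    rewrite (leq_trans h1) ?(leq_trans _ h2) // -e.
    by apply: pathfam_mono fam _ lt _ => //; apply: ltnW.
  move=> x y xV yV e; have [lt|lt|e2] := ltngtP x.2 y.2; first exact: key.
    by apply/esym/key.
  by apply: aV => //; rewrite /gridcmp e2 leqnn !andbT leq_total.
rewrite [X in _ <= X]big_mkcond /=; apply: leq_sum => x _.
case: ifP => [_|/negbT]; last first.
  rewrite inE negb_exists => /forallP none.
  by rewrite (_ : [set r : 'I_k | _] = set0) ?cards0 ?muln0 //; apply/setP => r;
    rewrite !inE (negbTE (none r)).
rewrite -[X in _ <= X]muln1 leq_mul //; apply/card_le1_eqP => r r'.
have no (s s' : 'I_k) : s < s' -> Js x.2 s <= x.1 <= Js x.2.+1 s ->
    Js x.2 s' <= x.1 <= Js x.2.+1 s' -> False.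
  move=> lt /andP[_ h1] /andP[h2 _].
  have [_ H] := fam; have [_ h3] := H _ (ltn_ord x.2) s (ltn_ord s).
  have h4 := h3 (leq_ltn_trans lt (ltn_ord s')).
  have inc := pathfam_incr fam (ltnW (ltn_ord x.2)).
  have : Js x.2 s.+1 <= Js x.2 s'.
    move: lt; rewrite leq_eqVlt => /predU1P[->|lt] //.
    by apply/ltnW/(incr_on_lt inc).
  move=> h5; have := leq_trans h4 h5; move=> h6; have := leq_trans (leq_trans h6 h2) h1.
  by rewrite ltnn.
rewrite !inE => hr hr'; have [lt|lt|/val_inj //] := ltngtP r r'; first by case: (no _ _ lt).
by case: (no _ _ lt).
Qed.

Lemma gk_le_famweight A k p q : k <= p -> k <= q ->
  exists Js, [/\ pathfam k q Js, (forall r, r < k -> Js q r = p - k + r),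
    (forall d r, d <= q -> r < k -> Js d r < p) &
    gkgrid k p q A <= famweight A k q Js].
Proof.
move=> kp kq; have [U wU eU] := gkmax_ex (@gridcmp p q) (fun x => A x.1 x.2) k.
(* [J d r] below is the first row where [H] exceeds [r]; the last two terms force the paths
   to start in the rows [0 .. k-1] and to end in the rows [p-k .. p-1]. *)
pose H i c := maxn (layer U i c) (maxn (i - (p - k)) (minn i (k - c))).
have mH c : {homo H^~ c : i j / i <= j}.
  by move=> i j ij; rewrite /H; have := layer_mono U ij (leqnn c); lia.
have aH i c : H i c.+1 <= H i c.
  by rewrite /H; have := layer_mono U (leqnn i) (leqnSn c); lia.
have dH i c : H i.+1 c <= (H i c.+1).+1.
  by rewrite /H; have := layer_drop U i c; lia.
have cH x : x \in U -> H x.1 x.2.+1 < k /\ H x.1 x.2.+1 < H x.1.+1 x.2.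
  move=> xU; have [h1 h2] := layer_cover xU wU; rewrite /H.
  by move: h1 h2 (ltn_ord x.1); move: (layer _ _ _) (layer _ _ _) => l1 l2; move: (x.1 : nat) (x.2 : nat); clear -kp; lia.
pose J := level p H.
have lvl c r i : i < p -> (J c r <= i) = (r < H i.+1 c) by move=> ip; apply: level_le.
have pJ d r : r < k -> J d r < p.
  have pk : r < k -> p.-1.+1 = p by lia.
  move=> rk; rewrite -(pk rk) ltnS lvl //; last by rewrite -(pk rk).
  by rewrite (pk rk) /H; lia.
have eJ d r m : r < k -> m < p -> r < H m.+1 d -> H m d <= r -> J d r = m.
  move=> rk mp h1 h2; apply/eqP; rewrite eqn_leq lvl // h1 /=.
  case: m mp h1 h2 => // m mp _ h2.
  by rewrite ltnNge (lvl _ _ _ (ltnW mp)) // -leqNgt.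
exists J; split => [|r rk|d r dq rk|].
- split => [r rk|d dq r rk].
    apply: eJ => //; rewrite /H; first by lia.
      by lia.
    by have := layer_row U r 0; lia.
  split.
    by rewrite lvl ?pJ //; apply: leq_trans (aH _ _); rewrite -lvl ?pJ.
  move=> rk'; have := leqnn (J d r.+1); rewrite lvl ?pJ //.
  have := pJ d _ rk'; case: (J d r.+1) => [|i] ip h; last first.
    by rewrite ltnS (lvl _ _ _ (ltnW ip)); have := dH i.+1 d; lia.
  by move: h; rewrite /H; have := layer_row U 1 d; lia.
- apply: eJ => //; rewrite /H ?layer_col0 //; lia.
- exact: pJ.
rewrite /gkgrid eU (@famweightE _ _ p) => [|d r _]; last exact: pJ.
rewrite big_mkcond /=; apply: leq_sum => x _; case: ifP => // xU.
rewrite -[X in X <= _]muln1 leq_mul // card_gt0; apply/set0Pn.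
have [h1 h2] := cH _ xU; exists (Ordinal h1); rewrite inE /= lvl // h2 /=.
have := ltn_ord x.1; case E : (x.1 : nat) => [|i] // ip.
by rewrite ltnNge (lvl _ _ _ (ltnW ip)) // -E -leqNgt.
Qed.

(** The chosen minor counts disjoint paths from the first k rows to the last k rows; prolonging
    chains to such paths can only add weight. The bound on q gives them room: path r cannot leave
    row r before column k-1-r. *)
Lemma size_pdet_gk A k p q : k <= p -> k <= q ->
  size (pdet A q k (fun r => p - k + r)) = (gkgrid k p q A).+1.
Proof.
move=> kp kq; apply/eqP; rewrite eqn_leq; apply/andP; split; last first.
  have [Js [fam eJ bJ le]] := gk_le_famweight A kp kq.
  by rewrite -(eq_pdet _ _ eJ); apply: leq_ltn_trans le (size_pdet_ge A fam).
have [->|D0] := eqVneq (pdet A q k (fun r => p - k + r)) 0%R; first by rewrite size_poly0.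
have inc : incr_on k (fun r => p - k + r) by move=> r _; rewrite addnS.
have [Js [fam eJ ->]] := size_pdet_le inc D0; rewrite ltnS; apply: famweight_le_gk => // d r dq rk.
by apply: leq_ltn_trans (pathfam_mono fam rk dq (leqnn q)) _; rewrite eJ //; lia.
Qed.

Lemma pdet_gk_neq0 A k p q : k <= p -> k <= q -> pdet A q k (fun r => p - k + r) != 0%R.
Proof. by move=> kp kq; rewrite -size_poly_gt0 size_pdet_gk. Qed.

(** * The Desnanot-Jacobi identity *)

Section Dodgson.
Import GRing.Theory.
Local Open Scope ring_scope.

(** A permutation other than the identity and the transposition of the two extreme indices moves
    some inner index, whose column is a column of the identity matrix; its term vanishes. *)
Lemma det_two_cols (R : comNzRingType) n (M : 'M[R]_n.+2) :
  \det (\matrix_(i, j) (if (j == ord0) || (j == ord_max) then M i j else (i == j)%:R)) =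
  M ord0 ord0 * M ord_max ord_max - M ord_max ord0 * M ord0 ord_max.
Proof.
set Z := (\matrix_(i, j) _).
have om : (ord_max == ord0 :> 'I_n.+2) = false by [].
pose t : 'S_n.+2 := tperm ord0 ord_max.
have t1 : t != 1%g.
  by apply/eqP => /permP /(_ ord0) /eqP; rewrite tpermL perm1 om.
rewrite -det_tr /determinant (bigD1 1%g) //= (bigD1 t) //= [X in _ + (_ + X)]big1 ?addr0; last first.
  move=> s /andP[s1 st]; suff [i i0 si] : exists2 i, (i != ord0) && (i != ord_max) & s i != i.
    rewrite (bigD1 i) //= !mxE -negb_or in i0 *.
    by rewrite (negbTE i0) (negbTE si) mul0r mulr0.
  apply/exists_inP; apply: contraT; rewrite negb_exists_in => /forall_inP fx.
  have {}fx i : i != ord0 -> i != ord_max -> s i = i.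
    by move=> h1 h2; apply/eqP/negbNE/fx; rewrite h1 h2.
  have hs i j : s j = j -> s i = j -> i = j by move=> e1 e2; apply: (@perm_inj _ s); rewrite e1.
  have s0 : (s ord0 == ord0) || (s ord0 == ord_max).
    apply: contraT; rewrite negb_or => /andP[h1 h2].
    by have := hs ord0 _ (fx _ h1 h2) erefl => e; rewrite -e eqxx in h1.
  have sm : (s ord_max == ord0) || (s ord_max == ord_max).
    apply: contraT; rewrite negb_or => /andP[h1 h2].
    by have := hs ord_max _ (fx _ h1 h2) erefl => e; rewrite -e eqxx in h2.
  case/orP: s0 => /eqP s0.
    case/negP: s1; apply/eqP/permP => i; rewrite perm1.
    have [->//|i0] := eqVneq i ord0; have [->|im] := eqVneq i ord_max; last exact: fx.
    case/orP: sm => /eqP // sm; have /perm_inj /eqP : s ord0 = s ord_max by rewrite s0 sm.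
    by rewrite eq_sym om.
  case/negP: st; apply/eqP/permP => i; rewrite permE /=.
  have [->|i0] := eqVneq i ord0; first by rewrite s0.
  have [->|im] := eqVneq i ord_max; last exact: fx.
  case/orP: sm => /eqP // sm; have /perm_inj /eqP : s ord0 = s ord_max by rewrite s0 sm.
  by rewrite eq_sym om.
have P (s : 'S_n.+2) : (forall i, i != ord0 -> i != ord_max -> s i = i) ->
   \prod_i Z^T i (s i) = Z (s ord0) ord0 * Z (s ord_max) ord_max.
  move=> fx; rewrite (bigD1 ord0) //= (bigD1 ord_max) //= big1 ?mulr1 ?mxE //.
  by move=> i /andP[h1 h2]; rewrite !mxE fx // (negbTE h1) (negbTE h2) /= eqxx.
rewrite !P => [|i h1 h2|i _ _]; last by rewrite perm1.
  by rewrite odd_perm1 odd_tperm eq_sym om !perm1 tpermL tpermR !mxE /= !expr0 mul1r expr1 mulN1r !eqxx.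
by rewrite /t tpermD // eq_sym.
Qed.

Lemma bump_ord k (i : 'I_k) : bump k i = i.
Proof. by rewrite /bump leqNgt ltn_ord. Qed.

Definition fdet (R : comNzRingType) (y : nat -> nat -> R) a b m :=
  \det (\matrix_(i < m, j < m) y (a + i)%N (b + j)%N).

(** The classical adjugate argument: [Z] is the identity with its first and last columns taken from
    the adjugate of [Y]. The determinant of [Y *m Z] is the square of [\det Y] times the inner
    minor, and one factor [\det Y] is cancelled. *)
Lemma dodgson (R : idomainType) (y : nat -> nat -> R) n :
  fdet y 0 0 n.+2 != 0 ->
  fdet y 0 0 n.+2 * fdet y 1 1 n =
  fdet y 0 0 n.+1 * fdet y 1 1 n.+1 - fdet y 0 1 n.+1 * fdet y 1 0 n.+1.
Proof.
set Y := \matrix_(i < n.+2, j < n.+2) y (0 + i)%N (0 + j)%N.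
rewrite {1 2}/fdet -/Y => dY.
set Z := (\matrix_(i, j) (if (j == ord0) || (j == ord_max) then \adj Y i j else (i == j)%:R)).
have dZ : \det Z = fdet y 0 0 n.+1 * fdet y 1 1 n.+1 - fdet y 0 1 n.+1 * fdet y 1 0 n.+1.
  rewrite det_two_cols !mxE /cofactor /=.
  have e00 : \det (row' ord0 (col' ord0 Y)) = fdet y 1 1 n.+1.
    by congr (\det _); apply/matrixP => i j; rewrite !mxE.
  have emm : \det (row' ord_max (col' ord_max Y)) = fdet y 0 0 n.+1.
    by congr (\det _); apply/matrixP => i j; rewrite !mxE /= ?bump_ord.
  have e0m : \det (row' ord0 (col' ord_max Y)) = fdet y 1 0 n.+1.
    by congr (\det _); apply/matrixP => i j; rewrite !mxE /= ?bump_ord.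
  have em0 : \det (row' ord_max (col' ord0 Y)) = fdet y 0 1 n.+1.
    by congr (\det _); apply/matrixP => i j; rewrite !mxE /= ?bump_ord.
  rewrite e00 emm e0m em0 !addn0 !add0n expr0 mul1r exprD mulrACA -!expr2 sqrr_sign.
  by rewrite !mul1r [X in X - _]mulrC [X in _ - X]mulrC.
have : \det (Y *m Z) = \det Y ^+ 2 * fdet y 1 1 n.
  have adjE i j : \sum_k Y i k * \adj Y k j = if i == j then \det Y else 0.
    by have /matrixP /(_ i j) := mul_mx_adj Y; rewrite !mxE mulrb.
  have YZ0 i : (Y *m Z) i ord0 = if i == ord0 then \det Y else 0.
    by rewrite -adjE mxE; apply: eq_bigr => k _; rewrite [Z _ _]mxE.
  have YZm i : (Y *m Z) i ord_max = if i == ord_max then \det Y else 0.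
    by rewrite -adjE mxE; apply: eq_bigr => k _; rewrite [Z _ _]mxE eqxx orbT.
  have YZi i j : j != ord0 -> j != ord_max -> (Y *m Z) i j = Y i j.
    move=> h1 h2; rewrite mxE (bigD1 j) //= big1 ?addr0 => [|k kj].
      by rewrite [Z _ _]mxE (negbTE h1) (negbTE h2) eqxx mulr1.
    by rewrite [Z _ _]mxE (negbTE h1) (negbTE h2) (negbTE kj) mulr0.
  move: (Y *m Z) YZ0 YZm YZi => W W0 Wm Wi.
  rewrite (expand_det_col _ ord0) (bigD1 ord0) //= W0 eqxx [X in _ + X]big1 ?addr0; last first.
    by move=> i i0; rewrite W0 (negbTE i0) mul0r.
  rewrite /cofactor addn0 expr0 mul1r expr2 -mulrA; congr (_ * _).
  have lm : lift ord0 ord_max = ord_max :> 'I_n.+2 by apply: val_inj.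
  have W'm i : row' ord0 (col' ord0 W) i ord_max = if i == ord_max then \det Y else 0.
    by rewrite !mxE lm Wm -lm (inj_eq lift_inj).
  rewrite (expand_det_col _ ord_max) (bigD1 ord_max) //= W'm eqxx [X in _ + X]big1 ?addr0; last first.
    by move=> i i0; rewrite W'm (negbTE i0) mul0r.
  rewrite /cofactor -signr_odd oddD addbb expr0 mul1r; congr (_ * \det _).
  apply/matrixP => i j; rewrite !mxE Wi ?mxE ?lift0 //=; last first.
    by rewrite -lm (inj_eq lift_inj) eq_sym neq_lift.
  by rewrite ?bump_ord.
rewrite det_mulmx dZ expr2 -mulrA => /(mulfI dY) ->.
by [].
Qed.

End Dodgson.

(** * Octahedron recurrences *)

Section OctahedronLarge.
Import GRing.Theory.

Lemma octahedron_large k p q A : 0 < k -> k <= p -> k < q ->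
  gkgrid k p.+1 q A + gkgrid k p.+1 q (fun i => A i.+1) =
  maxn (gkgrid k p.+2 q A + gkgrid k p q (fun i => A i.+1))
       (gkgrid k.+1 p.+2 q A + gkgrid k.-1 p q (fun i => A i.+1)).
Proof.
case: k => // n _ np nq; pose A' i := A i.+1.
pose y i j := transfer A q i (p - n + j).
have fdE a b m (B : nat -> nat -> nat) P :
    (forall i j, i < m -> j < m -> y (a + i) (b + j) = transfer B q i (P - m + j)) ->
    fdet y a b m = pdet B q m (fun r => P - m + r).
  by move=> H; congr (\det _)%R; apply/matrixP => i j; rewrite !mxE H.
have e1 : fdet y 0 0 n.+2 = pdet A q n.+2 (fun r => p.+2 - n.+2 + r) by apply: fdE.
have e2 : fdet y 1 1 n = pdet A' q n (fun r => p - n + r).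
  by apply: fdE => i j _ _; rewrite /y addnCA !add1n transfer_shift.
have e3 : fdet y 0 0 n.+1 = pdet A q n.+1 (fun r => p.+1 - n.+1 + r) by apply: fdE.
have e4 : fdet y 1 1 n.+1 = pdet A' q n.+1 (fun r => p.+1 - n.+1 + r).
  by apply: fdE => i j _ _; rewrite /y addnCA !add1n transfer_shift.
have e5 : fdet y 0 1 n.+1 = pdet A q n.+1 (fun r => p.+2 - n.+1 + r).
  by apply: fdE => i j _ _; rewrite /y; congr transfer; lia.
have e6 : fdet y 1 0 n.+1 = pdet A' q n.+1 (fun r => p - n.+1 + r).
  apply: fdE => i j _ _; rewrite /y add1n (_ : p - n + (0 + j) = (p - n.+1 + j).+1) ?transfer_shift //.
  lia.
have inc P m : incr_on m (fun r => P - m + r) by move=> r _; rewrite addnS.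
have := @dodgson _ y n; rewrite e1 e2 e3 e4 e5 e6 pdet_gk_neq0 ?ltnS ?(ltnW np) //.
move=> /(_ isT) /eqP; rewrite eq_sym subr_eq => /eqP /(congr1 (fun u : {poly int} => size u)).
have hn := ltnW np; have hq := ltnW nq; have hp := leqW np; have hp' := leqW hp; have hqq := ltnW hq.
pose D B P m := pdet B q m (fun r => P - m + r).
have szM m m' P P' B B' : m <= P -> m <= q -> m' <= P' -> m' <= q ->
   size (D B P m * D B' P' m')%R = (gkgrid m P q B + gkgrid m' P' q B').+1.
  by move=> ? ? ? ?; rewrite size_mul ?pdet_gk_neq0 // !size_pdet_gk // addSn addnS.
have nnM m m' P P' B B' : nnpoly (D B P m * D B' P' m')%R.
  by apply: nnpolyM; apply: pdet_nn.
rewrite -!/(D _ _ _) size_add_nn // !szM //.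
by rewrite maxnSS maxnC => -[].
Qed.

(* Zero rows inserted after the first one, and zero columns, make the grid large enough. *)

End OctahedronLarge.

Lemma octahedron k p q A : 0 < k ->
  gkgrid k p.+1 q A + gkgrid k p.+1 q (fun i => A i.+1) =
  maxn (gkgrid k p.+2 q A + gkgrid k p q (fun i => A i.+1))
       (gkgrid k.+1 p.+2 q A + gkgrid k.-1 p q (fun i => A i.+1)).
Proof.
(* The strict bound of [octahedron_large] on the number of columns must hold even for q = 0, which
   dictates k+1. The zero rows go between row 0 and the others so that deleting the first or the
   last row still deletes that row of [A]. *)
move=> k0; pose d := k.+1.
pose A' i j := if j < q then if i == 0 then A 0 j else if i <= d then 0 else A (i - d) j else 0.
have pad0 l P : gkgrid l P q A = gkgrid l (if P is 0 then 0 else P + d) (q + d) A'.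
  apply: (@gkgrid_emb _ _ _ _ _ _ _ (fun i => if i is 0 then 0 else i + d) id) => //.
  - by case: P => // P [|i] /=; lia.
  - by move=> j jq; apply: ltn_addr.
  - by move=> [|i] [|j] _ _ //=; lia.
  - move=> [|i] j _ jq; rewrite /A' jq //=; case: ifP; first lia.
    by rewrite addnK.
  - move=> i j iP jq no; rewrite /A'; case: ltnP => // jq'.
    case: i iP no => [|i] iP no /=.
      by case: P iP no => // P _ []; exists 0, j.
    case: ltnP => // di; case: no; exists (i.+1 - d), j; split => //; first by case: P iP => // P; lia.
    by case E : (i.+1 - d) => [|m]; lia.
have pad1 l P : gkgrid l P q (fun i => A i.+1) = gkgrid l (P + d) (q + d) (fun i => A' i.+1).
  apply: (@gkgrid_emb _ _ _ _ _ _ _ (fun i => i + d) id) => //.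
  - by move=> i; rewrite ltn_add2r.
  - by move=> j jq; apply: ltn_addr.
  - by move=> i j _ _ /=; rewrite leq_add2r.
  - move=> i j _ jq; rewrite /A' jq /=; case: ifP; first lia.
    by rewrite -addSn addnK.
  - move=> i j iP jq no; rewrite /A' /=; case: ltnP => // jq'; case: ltnP => // di.
    by case: no; exists (i - d), j; split => //; lia.
rewrite !pad0 !pad1 !addSn; apply: octahedron_large => //; rewrite /d; lia.
Qed.

Definition heavy_corner q L (A : nat -> nat -> nat) (i j : nat) : nat :=
  if i is i'.+1 then A i' j else if j == q then L else 0.

(** The heavy entry is incomparable with all cells outside its row and column. A set containing it
    thus has width at most k-1 off the first row and the last column, while the last column together
    with the entry is a single chain. A set missing the entry weighs at most [L]. *)
Lemma gkgrid_heavy_corner k p q L (A : nat -> nat -> nat) : 0 < k ->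
  \sum_(i < p) \sum_(j < q.+1) A i j <= L ->
  gkgrid k p.+1 q.+1 (heavy_corner q L A) =
  L + \sum_(i < p) A i q + gkgrid k.-1 p q A.
Proof.
move=> k0 leL; set A' := heavy_corner q L A.
pose h (u : 'I_p * 'I_q) : 'I_p.+1 * 'I_q.+1 := (lift ord0 u.1, widen_ord (leqnSn q) u.2).
have hI : injective h.
  move=> [a b] [c d] e; congr (_, _); first exact: (lift_inj (congr1 fst e)).
  by apply: val_inj; apply: (congr1 (fun x => val x.2) e).
have hw u : A' (h u).1 (h u).2 = A u.1 u.2 by [].
have hq u : ((h u).2 == q :> nat) = false by rewrite /= ltn_eqF.
have hc u v : gridcmp (h u) (h v) = gridcmp u v by [].
have colE : \sum_(x : 'I_p.+1 * 'I_q.+1 | x.2 == q :> nat) A' x.1 x.2 = L + \sum_(i < p) A i q.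
  rewrite (eq_bigl (fun x : 'I_p.+1 * 'I_q.+1 => xpredT x.1 && (x.2 == q :> nat))) //.
  rewrite -(pair_big xpredT (fun j : 'I_q.+1 => j == q :> nat)
    (fun (i : 'I_p.+1) j => A' i j)) /=.
  have colj (i : 'I_p.+1) : \sum_(j < q.+1 | j == q :> nat) A' i j = A' i q.
    by rewrite (big_pred1 ord_max) // => j; rewrite -val_eqE.
  rewrite big_ord_recl; congr (_ + _); first by rewrite (colj ord0) /= eqxx.
  by apply: eq_bigr => i _; rewrite (colj (lift ord0 i)).
have hS (U : {set 'I_p * 'I_q}) : \sum_(x in h @: U) A' x.1 x.2 = \sum_(u in U) A u.1 u.2.
  by rewrite big_imset //= => u v _ _; apply: hI.
apply/eqP; rewrite eqn_leq; apply/andP; split.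
  rewrite {1}/gkgrid; have [U' wU' ->] := gkmax_ex (@gridcmp p.+1 q.+1) (fun x => A' x.1 x.2) k.
  have [cU|ncU] := boolP ((ord0, ord_max) \in U'); last first.
    rewrite -addnA; apply: leq_trans (leq_addr _ _); apply: leq_trans leL.
    rewrite (bigID (fun x : 'I_p.+1 * 'I_q.+1 => x.1 == ord0)) /= big1 ?add0n; last first.
      move=> [i j] /= /andP[xU /eqP i0]; rewrite i0 /= in xU *; case: ifP => // /eqP jq.
      by case/negP: ncU; rewrite (_ : ord_max = j) //; apply: val_inj.
    apply: (@leq_trans (\sum_(x : 'I_p.+1 * 'I_q.+1 | x.1 != ord0) A' x.1 x.2)).
      by rewrite [X in _ <= X](bigID (fun x => x \in U')) /= (eq_bigl _ _ (fun x => andbC _ _)) leq_addr.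
    rewrite (eq_bigl (fun x : 'I_p.+1 * 'I_q.+1 => (x.1 != ord0) && xpredT x.2)); last first.
      by move=> x; rewrite andbT.
    rewrite -(pair_big (fun i : 'I_p.+1 => i != ord0) xpredT (fun i (j : 'I_q.+1) => A' i j)) /=.
    rewrite big_mkcond big_ord_recl /= add0n leq_eqVlt; apply/orP; left; apply/eqP.
    by apply: eq_bigr.
  rewrite (bigID (fun x : 'I_p.+1 * 'I_q.+1 => x.2 == q :> nat)) /=; apply: leq_add.
    rewrite -colE [X in _ <= X](bigID (fun x => x \in U')) /=.
    by rewrite (eq_bigl _ _ (fun x => andbC _ _)) leq_addr.
  pose U := h @^-1: U'.
  apply: (@leq_trans (\sum_(u in U) A u.1 u.2)); last first.
    apply: (@gkmax_ge _ (@gridcmp p q) (fun x => A x.1 x.2) k.-1 U); apply/width_leP => V sV aV.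
    have hV : #|(ord0, ord_max) |: h @: V| <= k.
      apply: (width_leP _ _ _ wU').
        rewrite subUset sub1set cU /=; apply/subsetP => _ /imsetP[u uV ->].
        by move/subsetP: sV => /(_ u uV); rewrite inE.
      have nc u : ~~ gridcmp ((ord0, ord_max) : 'I_p.+1 * 'I_q.+1) (h u).
        by rewrite /gridcmp /= [q <= _]leqNgt ltn_ord.
      have nc' u : ~~ gridcmp (h u) ((ord0, ord_max) : 'I_p.+1 * 'I_q.+1).
        by have := nc u; rewrite /gridcmp orbC.
      apply/antichainP => x y; rewrite !inE.
      move=> /predU1P[->|/imsetP[u uV ->]] /predU1P[->|/imsetP[v vV ->]] //.
      - by move=> e; have := nc v; rewrite e.
      - by move=> e; have := nc' u; rewrite e.
      by rewrite hc => /(antichainP _ _ aV) ->.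
    move: hV; rewrite cardsU1 (card_imset _ hI) (_ : _ \notin _) /=; first by lia.
    by apply/imsetP => -[u _ /(congr1 (fun x => val x.1))].
  rewrite -hS [X in X <= _]big_mkcond [X in _ <= X]big_mkcond /=; apply: leq_sum => -[i j] _ /=.
  case: ifP => // /andP[xU jq]; case: ifP => // /negbT nh.
  case: (unliftP ord0 i) => [i' ei|->] /=; last by rewrite (negbTE jq).
  have jlt : j < q by rewrite ltn_neqAle jq -ltnS ltn_ord.
  case/negP: nh; apply/imsetP; have e : (i, j) = h (i', Ordinal jlt).
    by rewrite ei; congr (_, _); apply: val_inj.
  by exists (i', Ordinal jlt); rewrite // inE -e.
rewrite {1}/gkgrid; have [U wU ->] := gkmax_ex (@gridcmp p q) (fun x => A x.1 x.2) k.-1.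
pose U' := [set x : 'I_p.+1 * 'I_q.+1 | x.2 == q :> nat] :|: h @: U.
have dis x : x \in h @: U -> (x.2 == q :> nat) = false by move=> /imsetP[u _ ->].
apply: leq_trans (gkmax_ge (U := U') _ _).
  rewrite (bigID (fun x : 'I_p.+1 * 'I_q.+1 => x.2 == q :> nat)) /= -colE -hS.
  apply: eq_leq; congr (_ + _); apply: eq_bigl => x; rewrite !inE.
    by case: (x.2 == q :> nat); rewrite ?andbF.
  by have := dis x; case: (x \in h @: U) => [->|_] //; case: (x.2 == q :> nat).
apply/width_leP => V sV aV; rewrite -(cardsID [set x : 'I_p.+1 * 'I_q.+1 | x.2 == q :> nat] V).
rewrite -(prednK k0) -[k.-1.+1]add1n leq_add //.
  apply/card_le1_eqP => x y; rewrite !inE => /andP[xV /eqP hx] /andP[yV /eqP hy].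
  by apply: (antichainP _ _ aV) => //; rewrite /gridcmp hx hy leqnn !andbT leq_total.
have sVh : V :\: [set x : 'I_p.+1 * 'I_q.+1 | x.2 == q :> nat] \subset h @: U.
  by apply/subsetP => x; rewrite inE => /andP[h1 /(subsetP sV)]; rewrite inE (negbTE h1).
set W := _ :\: _ in sVh *.
have -> : W = h @: (h @^-1: W).
  apply/setP => y; apply/idP/imsetP => [yV|[x + ->]]; last by rewrite inE.
  by have /imsetP[x xU yE] := subsetP sVh y yV; exists x => //; rewrite inE -yE.
rewrite card_imset //; apply: (width_leP _ _ _ wU).
  by apply/subsetP => x; rewrite inE => /(subsetP sVh) /imsetP[x' x'U /hI ->].
apply/antichainP => x y; rewrite inE => xW; rewrite inE => yW cxy; apply: hI.
move: xW yW; rewrite !inE => /andP[_ xV] /andP[_ yV].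
by apply: (antichainP _ _ aV) => //; rewrite hc.
Qed.

(* The extra row is so heavy in its last entry that an optimal union of chains spends
   one chain on that row and the last column; thus this is an instance of [octahedron]. *)
Lemma gkgrid_corner k p q A : 0 < k ->
  gkgrid k p.+1 q.+1 A + gkgrid k.-1 p q A =
  A p q + maxn (gkgrid k p.+1 q A + gkgrid k.-1 p q.+1 A)
               (gkgrid k.-1 p.+1 q A + gkgrid k p q.+1 A).
Proof.
move=> k0; pose L := \sum_(i < p.+1) \sum_(j < q.+1) A i j.
have leL : \sum_(i < p) \sum_(j < q.+1) A i j <= L by rewrite /L big_ord_recr /= leq_addr.
have := @octahedron k p q.+1 (heavy_corner q L A) k0.
rewrite !gkgrid_heavy_corner // big_ord_recr /=.
rewrite (_ : (fun i => _) = A) //; lia.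
Qed.

Lemma gkgrid_row0 k p q A : (forall j, j < q -> A 0 j = 0) ->
  gkgrid k p.+1 q A = gkgrid k p q (fun i => A i.+1).
Proof.
move=> A0; apply/esym/(@gkgrid_emb _ _ _ _ _ _ _ S id) => // i j ip jq no.
by case: i ip no => [|i] ip no; [apply: A0 | case: no; exists i, j].
Qed.

Lemma gkgrid_col0 k p q A : (forall i, i < p -> A i q = 0) ->
  gkgrid k p q.+1 A = gkgrid k p q A.
Proof.
move=> A0; apply/esym/(@gkgrid_emb _ _ _ _ _ _ _ id id) => //; first by move=> j /ltnW.
move=> i j ip; rewrite ltnS leq_eqVlt => /predU1P[->|jq] no; first exact: A0.
by case: no; exists i, j.
Qed.

(** This is [octahedron] for [A] below an added zero row, keeping one of the two terms of the
    maximum. *)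
Lemma gkgrid_interlace1 k p q A : 0 < k ->
  gkgrid k.+1 p.+1 q A + gkgrid k.-1 p q A <= gkgrid k p.+1 q A + gkgrid k p q A.
Proof.
move=> k0; pose A0 i := if i is i'.+1 then A i' else fun _ => 0.
have r0 l m : gkgrid l m.+1 q A0 = gkgrid l m q A by apply: (@gkgrid_row0 l m q A0).
by have := @octahedron k p q A0 k0; rewrite !r0 addnC => ->; apply: leq_maxr.
Qed.

(** This is [gkgrid_corner] with an added zero column, again keeping one term of the maximum. *)
Lemma gkgrid_interlace2 k p q A : 0 < k ->
  gkgrid k.-1 p.+1 q A + gkgrid k p q A <= gkgrid k p.+1 q A + gkgrid k.-1 p q A.
Proof.
move=> k0; pose A' i j := if j < q then A i j else 0.
have := @gkgrid_corner k p q A' k0.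
have z i : A' i q = 0 by rewrite /A' ltnn.
have c0 l m : gkgrid l m q.+1 A' = gkgrid l m q A'.
  by apply: gkgrid_col0 => i _; apply: z.
have e l m : gkgrid l m q A' = gkgrid l m q A by apply: eq_gkgrid => i j _ jq; rewrite /A' jq.
rewrite z !c0 !e; lia.
Qed.

(** * Greene-Kleitman partitions of a product of two sequences *)

Definition gkseq (s t : seq nat) (f : nat -> nat -> nat) (k : nat) : nat :=
  gkgrid k (size s) (size t) (fun i j => f (nth 0 s i) (nth 0 t j)).
(** Parts are numbered from 0: index i is the part number i+1 of the partition. *)
Definition gkpart s t f i : nat := gkseq s t f i.+1 - gkseq s t f i.

Lemma gkseq0 s t f : gkseq s t f 0 = 0.
Proof. exact: gkgrid0. Qed.

Lemma gkseq_mono s t f k : gkseq s t f k <= gkseq s t f k.+1.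
Proof. exact: gkgrid_mono. Qed.

Lemma eq_gkseq s t f g : {in s & t, f =2 g} -> gkseq s t f =1 gkseq s t g.
Proof. by move=> e k; apply: eq_gkgrid => i j ip jq; apply: e; apply: mem_nth. Qed.

Lemma gkseq_tr s t f : gkseq s t f =1 gkseq t s (fun x y => f y x).
Proof. by move=> k; apply: gkgrid_tr. Qed.

Lemma gkseq_rev s t f : gkseq (rev s) (rev t) f =1 gkseq s t f.
Proof.
move=> k; rewrite /gkseq !size_rev [RHS]gkgrid_rev.
by apply: eq_gkgrid => i j ip jq; rewrite !nth_rev.
Qed.

Lemma gkpart_tr s t f : gkpart s t f =1 gkpart t s (fun x y => f y x).
Proof. by move=> k; rewrite /gkpart !(gkseq_tr s t). Qed.

Lemma gkpart_rev s t f : gkpart (rev s) (rev t) f =1 gkpart s t f.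
Proof. by move=> k; rewrite /gkpart !gkseq_rev. Qed.

(** The difference of [octahedron] for i+1 and for i chains: after the common terms are pulled out,
    one maximum leaves a maximum of parts and the other, being subtracted, a minimum. *)
Lemma gkpart_octahedron x y s t f i :
  let a := gkpart s t f in let d := gkpart (x :: rcons s y) t f in
  gkpart (rcons s y) t f i + gkpart (x :: s) t f i =
  maxn (a i) (d i.+1) + (if i is i'.+1 then minn (a i') (d i) else d i).
Proof.
move=> a d.
have E k : 0 < k -> gkseq (x :: s) t f k + gkseq (rcons s y) t f k =
    maxn (gkseq (x :: rcons s y) t f k + gkseq s t f k)
         (gkseq (x :: rcons s y) t f k.+1 + gkseq s t f k.-1).
  move=> k0; pose A i j := f (nth 0 (x :: rcons s y) i) (nth 0 t j).
  have e1 l : gkgrid l (size s) (size t) (fun i => A i.+1) = gkseq s t f l.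
    by apply: eq_gkgrid => i' m jp _; rewrite /A /= nth_rcons jp.
  have e2 l : gkgrid l (size s).+2 (size t) A = gkseq (x :: rcons s y) t f l.
    by rewrite /gkseq /= size_rcons.
  have e3 l : gkgrid l (size s).+1 (size t) (fun i => A i.+1) = gkseq (rcons s y) t f l.
    by rewrite /gkseq size_rcons.
  have e4 l : gkgrid l (size s).+1 (size t) A = gkseq (x :: s) t f l.
    by apply: eq_gkgrid => -[|j] m jp _ //; rewrite /A /= nth_rcons (_ : j < size s).
  by have := @octahedron k (size s) (size t) A k0; rewrite !e1 !e2 !e3 !e4.
have := E i.+1 isT; rewrite /a /d /gkpart.
have := gkseq_mono s t f i; have := gkseq_mono (x :: s) t f i.
have := gkseq_mono (rcons s y) t f i; have := gkseq_mono (x :: rcons s y) t f i.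
have := gkseq_mono (x :: rcons s y) t f i.+1.
case: i => [|i].
  by rewrite !gkseq0 /=; lia.
have := E i.+1 isT; have := gkseq_mono s t f i; have := gkseq_mono (x :: s) t f i.
have := gkseq_mono (rcons s y) t f i; have := gkseq_mono (x :: rcons s y) t f i.
by rewrite /=; lia.
Qed.

(** Fomin's local rule of RSK in piecewise linear form, obtained by differencing [gkgrid_corner]. *)
Lemma gkpart_corner_last x y s t f :
  let n11 := gkpart (rcons s x) (rcons t y) f in let n10 := gkpart (rcons s x) t f in
  let n01 := gkpart s (rcons t y) f in let n00 := gkpart s t f in
  n11 0 = f x y + maxn (n10 0) (n01 0) /\
  forall i, n11 i.+1 + n00 i = maxn (n10 i.+1) (n01 i.+1) + minn (n10 i) (n01 i).
Proof.
move=> n11 n10 n01 n00.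
have E k : 0 < k -> gkseq (rcons s x) (rcons t y) f k + gkseq s t f k.-1 = f x y +
    maxn (gkseq (rcons s x) t f k + gkseq s (rcons t y) f k.-1)
         (gkseq (rcons s x) t f k.-1 + gkseq s (rcons t y) f k).
  move=> k0; pose A i j := f (nth 0 (rcons s x) i) (nth 0 (rcons t y) j).
  have := @gkgrid_corner k (size s) (size t) A k0.
  have -> : A (size s) (size t) = f x y by rewrite /A !nth_rcons !ltnn !eqxx.
  have e11 l : gkgrid l (size s).+1 (size t).+1 A = gkseq (rcons s x) (rcons t y) f l.
    by rewrite /gkseq !size_rcons.
  have e10 l : gkgrid l (size s).+1 (size t) A = gkseq (rcons s x) t f l.
    rewrite /gkseq size_rcons; apply: eq_gkgrid => i j _ jt.
    by rewrite /A [nth 0 (rcons t y) j]nth_rcons jt.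
  have e01 l : gkgrid l (size s) (size t).+1 A = gkseq s (rcons t y) f l.
    rewrite /gkseq size_rcons; apply: eq_gkgrid => i j js _.
    by rewrite /A [nth 0 (rcons s x) i]nth_rcons js.
  have e00 l : gkgrid l (size s) (size t) A = gkseq s t f l.
    by apply: eq_gkgrid => i j js jt; rewrite /A !nth_rcons js jt.
  by rewrite !e11 !e10 !e01 !e00.
have m11 := gkseq_mono (rcons s x) (rcons t y) f; have m00 := gkseq_mono s t f.
have m10 := gkseq_mono (rcons s x) t f; have m01 := gkseq_mono s (rcons t y) f.
rewrite /n11 /n10 /n01 /n00 /gkpart; split.
  by have := E 1 isT; rewrite /= !gkseq0; lia.
move=> i; have := E i.+1 isT; have := E i.+2 isT => /=.
have := m11 i; have := m11 i.+1; have := m10 i; have := m10 i.+1.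
have := m01 i; have := m01 i.+1; have := m00 i; lia.
Qed.

Lemma gkpart_interlace_rcons y s t f i :
  gkpart (rcons s y) t f i.+1 <= gkpart s t f i <= gkpart (rcons s y) t f i.
Proof.
pose A i j := f (nth 0 (rcons s y) i) (nth 0 t j).
have e1 l : gkgrid l (size s).+1 (size t) A = gkseq (rcons s y) t f l.
  by rewrite /gkseq size_rcons.
have e0 l : gkgrid l (size s) (size t) A = gkseq s t f l.
  by apply: eq_gkgrid => j m js _; rewrite /A nth_rcons js.
have := @gkgrid_interlace1 i.+1 (size s) (size t) A isT.
have := @gkgrid_interlace2 i.+1 (size s) (size t) A isT.
rewrite !e1 !e0 /gkpart /=.
have := gkseq_mono (rcons s y) t f i; have := gkseq_mono (rcons s y) t f i.+1.
have := gkseq_mono s t f i; lia.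
Qed.

Lemma gkpart_interlace_cons y s t f i :
  gkpart (y :: s) t f i.+1 <= gkpart s t f i <= gkpart (y :: s) t f i.
Proof.
by rewrite -!(gkpart_rev (y :: s)) -(gkpart_rev s) rev_cons gkpart_interlace_rcons.
Qed.

Lemma gkpart_corner_first x y s t f :
  let n11 := gkpart (x :: s) (y :: t) f in let n10 := gkpart (x :: s) t f in
  let n01 := gkpart s (y :: t) f in let n00 := gkpart s t f in
  n11 0 = f x y + maxn (n10 0) (n01 0) /\
  forall i, n11 i.+1 + n00 i = maxn (n10 i.+1) (n01 i.+1) + minn (n10 i) (n01 i).
Proof.
have [h1 h2] := gkpart_corner_last x y (rev s) (rev t) f.
split; first by move: h1; rewrite -!rev_cons !gkpart_rev.
by move=> i; move: (h2 i); rewrite -!rev_cons !gkpart_rev.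
Qed.

(** * Words and interlacing sequences *)

Section Words.
Implicit Types (isB up : pred nat) (u v w s t : seq nat) (f g : nat -> nat -> nat).

(** Reading one more row letter extends the chain at its end if the letter is up and at its front if
    it is down. *)
Definition rowseq (isB up : pred nat) (s : seq nat) : seq nat :=
  rev [seq x <- s | isB x && ~~ up x] ++ [seq x <- s | isB x && up x].
(** Arranged so that reading a column letter, which removes it from the remaining word, takes it off
    the front of the chain if it is up and off the end if it is down. *)
Definition colseq (isB up : pred nat) (s : seq nat) : seq nat :=
  [seq x <- s | ~~ isB x && up x] ++ rev [seq x <- s | ~~ isB x && ~~ up x].
Definition gkshape isB up w f m i : nat :=
  gkpart (rowseq isB up (take m w)) (colseq isB up (drop m w)) f i.
Definition interlacing (isB : pred nat) (w : seq nat) (mu : nat -> nat -> nat) : Prop :=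
  [/\ forall i, mu 0 i = 0, forall i, mu (size w) i = 0 &
      forall m i, m < size w ->
        if isB (nth 0 w m) then mu m.+1 i.+1 <= mu m i <= mu m.+1 i
        else mu m i.+1 <= mu m.+1 i <= mu m i].
Definition precedes (w : seq nat) x y : Prop :=
  exists m, x \in take m w /\ y \in drop m w.
(** Injectivity is claimed for the pairs in which the row letter comes before the column letter:
    these are the cells of the grids at the various cuts, so the shapes see no other value of f. *)
Definition gkshape_bij isB up w : Prop :=
  (forall mu, interlacing isB w mu ->
     exists f, forall m i, m <= size w -> gkshape isB up w f m i = mu m i) /\
  (forall f g, (forall m i, m <= size w -> gkshape isB up w f m i = gkshape isB up w g m i) ->
     forall x y, isB x -> ~~ isB y -> precedes w x y -> f x y = g x y).

Lemma rowseq_rcons isB up s x : isB x ->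
  rowseq isB up (rcons s x) = if up x then rcons (rowseq isB up s) x else x :: rowseq isB up s.
Proof.
move=> Bx; rewrite /rowseq !filter_rcons Bx /=; case: (up x) => /=.
  by rewrite rcons_cat.
by rewrite rev_rcons.
Qed.

Lemma rowseq_rconsN isB up s x : ~~ isB x -> rowseq isB up (rcons s x) = rowseq isB up s.
Proof. by move=> /negbTE Bx; rewrite /rowseq !filter_rcons Bx. Qed.

Lemma colseq_cons isB up s x : ~~ isB x ->
  colseq isB up (x :: s) = if up x then x :: colseq isB up s else rcons (colseq isB up s) x.
Proof.
move=> Bx; rewrite /colseq /= Bx /=; case: (up x) => //=.
by rewrite rev_cons rcons_cat.
Qed.

Lemma colseq_consN isB up s x : isB x -> colseq isB up (x :: s) = colseq isB up s.
Proof. by move=> Bx; rewrite /colseq /= Bx. Qed.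

Lemma mem_rowseq isB up s x : x \in rowseq isB up s = isB x && (x \in s).
Proof. by rewrite mem_cat mem_rev !mem_filter; case: (isB x); case: (up x); case: (x \in s). Qed.

Lemma mem_colseq isB up s x : x \in colseq isB up s = ~~ isB x && (x \in s).
Proof. by rewrite mem_cat mem_rev !mem_filter; case: (isB x); case: (up x); case: (x \in s). Qed.

Lemma gkpart_nil t f i : gkpart [::] t f i = 0.
Proof.
have e k : gkseq [::] t f k = 0.
  rewrite /gkseq /gkgrid; have [U _ ->] := gkmax_ex (@gridcmp 0 (size t))
     (fun x => f (nth 0 [::] x.1) (nth 0 t x.2)) k.
  by rewrite big1 // => -[[]].
by rewrite /gkpart !e.
Qed.

Lemma eq_gkshape isB up w f g m :
  (forall x y, isB x -> ~~ isB y -> x \in take m w -> y \in drop m w -> f x y = g x y) ->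
  gkshape isB up w f m =1 gkshape isB up w g m.
Proof.
move=> e i; rewrite /gkshape /gkpart !(@eq_gkseq _ _ f g) // => x y;
  rewrite mem_rowseq mem_colseq => /andP[? ?] /andP[? ?]; exact: e.
Qed.

Lemma gkshape_interlacing isB up w f : interlacing isB w (gkshape isB up w f).
Proof.
split=> [i|i|m i mw]; first by rewrite /gkshape take0 gkpart_nil.
  by rewrite /gkshape drop_size gkpart_tr gkpart_nil.
rewrite /gkshape (take_nth 0 mw) (drop_nth 0 mw).
case: ifP => [Bx|/negbT Bx].
  rewrite colseq_consN // rowseq_rcons //.
  by case: (up _); rewrite ?gkpart_interlace_rcons ?gkpart_interlace_cons.
rewrite rowseq_rconsN // colseq_cons // ![gkpart (rowseq _ _ _) _ _ _]gkpart_tr.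
by case: (up _); rewrite ?gkpart_interlace_rcons ?gkpart_interlace_cons.
Qed.

Lemma rowseq_swap isB up u v x y : (isB x, up x) != (isB y, up y) ->
  rowseq isB up (u ++ x :: y :: v) = rowseq isB up (u ++ y :: x :: v).
Proof.
rewrite /rowseq !filter_cat /=.
by case: (isB x); case: (isB y); case: (up x); case: (up y).
Qed.

Lemma colseq_swap isB up u v x y : (isB x, up x) != (isB y, up y) ->
  colseq isB up (u ++ x :: y :: v) = colseq isB up (u ++ y :: x :: v).
Proof.
rewrite /colseq !filter_cat /=.
by case: (isB x); case: (isB y); case: (up x); case: (up y).
Qed.

(** Where the cut m falls relative to the exchanged pair; in the middle case alone do the two words
    have different letters on each side. *)
Variant swap_index (T : Type) (u v : seq T) (x y : T) (m : nat) : Prop :=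
| SwapBefore of m <= size u & take m (u ++ x :: y :: v) = take m (u ++ y :: x :: v)
    & drop m (u ++ x :: y :: v) = drop m u ++ x :: y :: v
    & drop m (u ++ y :: x :: v) = drop m u ++ y :: x :: v
| SwapAt of m = (size u).+1
| SwapAfter m' of m = m' + (size u).+2 & drop m (u ++ x :: y :: v) = drop m (u ++ y :: x :: v)
    & take m (u ++ x :: y :: v) = u ++ x :: y :: take m' v
    & take m (u ++ y :: x :: v) = u ++ y :: x :: take m' v.

Lemma swap_indexP (T : Type) (u v : seq T) (x y : T) m : swap_index u v x y m.
Proof.
have [le|lt] := leqP m (size u).
  apply: SwapBefore => //; first by rewrite !takel_cat.
    by rewrite drop_cat; case: ltngtP le => // -> _; rewrite drop_size subnn.
  by rewrite drop_cat; case: ltngtP le => // -> _; rewrite drop_size subnn.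
have [->|ne] := eqVneq m (size u).+1; first exact: SwapAt.
have e : m = (m - (size u).+2) + (size u).+2 by lia.
have e' : m - size u = (m - (size u).+2).+2 by lia.
have nl : (m < size u) = false by lia.
by apply: SwapAfter e _ _ _; rewrite ?drop_cat ?take_cat nl e'.
Qed.

Lemma gkshape_swap isB up u v x y f m : (isB x, up x) != (isB y, up y) -> m != (size u).+1 ->
  gkshape isB up (u ++ x :: y :: v) f m = gkshape isB up (u ++ y :: x :: v) f m.
Proof.
move=> ne mu; rewrite /gkshape; case: (swap_indexP u v x y m) => [_ -> -> ->|em|m' _ -> -> ->].
- by rewrite (colseq_swap (drop m u) v ne).
- by rewrite em eqxx in mu.
- by rewrite (rowseq_swap u (take m' v) ne).
Qed.

Lemma gkshape_at0 isB up u v f i :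
  gkshape isB up (u ++ v) f (size u) i = gkpart (rowseq isB up u) (colseq isB up v) f i.
Proof. by rewrite /gkshape take_size_cat // drop_size_cat. Qed.

Lemma gkshape_at1 isB up u v x f i :
  gkshape isB up (u ++ x :: v) f (size u).+1 i =
  gkpart (rowseq isB up (rcons u x)) (colseq isB up v) f i.
Proof. by rewrite -cat_rcons -(size_rcons u x) gkshape_at0. Qed.

Lemma gkshape_at2 isB up u v x y f i :
  gkshape isB up (u ++ x :: y :: v) f (size u).+2 i =
  gkpart (rowseq isB up (rcons (rcons u x) y)) (colseq isB up v) f i.
Proof. by rewrite -!cat_rcons -(size_rcons u x) -(size_rcons (rcons u x) y) gkshape_at0. Qed.

Lemma nth_swap (u v : seq nat) x y m : m != size u -> m != (size u).+1 ->
  nth 0 (u ++ x :: y :: v) m = nth 0 (u ++ y :: x :: v) m.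
Proof.
move=> h1 h2; rewrite !nth_cat; case: ltnP => // h3.
have -> : m - size u = (m - (size u).+2).+2 by lia.
by [].
Qed.

Lemma nth_at0 (u v : seq nat) x : nth 0 (u ++ x :: v) (size u) = x.
Proof. by rewrite nth_cat ltnn subnn. Qed.

Lemma nth_at1 (u v : seq nat) x y : nth 0 (u ++ x :: y :: v) (size u).+1 = y.
Proof. by rewrite -cat_rcons -(size_rcons u x) nth_at0. Qed.

Definition modify_at n (mu : nat -> nat -> nat) (nu : nat -> nat) m i : nat :=
  if m == n then nu i else mu m i.

Lemma interlacing_modify isB u v x y mu nu : let n := size u in
  interlacing isB (u ++ x :: y :: v) mu ->
  (forall i, if isB y then nu i.+1 <= mu n i <= nu i else mu n i.+1 <= nu i <= mu n i) ->
  (forall i, if isB x then mu n.+2 i.+1 <= nu i <= mu n.+2 i else nu i.+1 <= mu n.+2 i <= nu i) ->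
  interlacing isB (u ++ y :: x :: v) (modify_at n.+1 mu nu).
Proof.
move=> n [h0 hs h] hy hx; have es : size (u ++ y :: x :: v) = size (u ++ x :: y :: v).
  by rewrite !size_cat.
rewrite /modify_at; split=> [i|i|m i]; first by rewrite h0.
  by rewrite es hs ifF //; apply/negbTE; rewrite size_cat /=; lia.
rewrite es => ms; have [->|m0] := eqVneq m n.
  by rewrite eqxx ltn_eqF // nth_at0; apply: hy.
have [->|m1] := eqVneq m n.+1.
  by rewrite gtn_eqF // nth_at1; apply: hx.
by rewrite eqSS (negbTE m0) (nth_swap _ y) //; apply: h.
Qed.

(** The Bender-Knuth involution on a row of a Gelfand-Tsetlin pattern: [nu i] is reflected in the
    interval that its neighbours in [a] and [b] allow. *)
Definition toggle (a b nu : nat -> nat) i : nat :=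
  maxn (a i) (b i.+1) + (if i is i'.+1 then minn (a i') (b i) else b i) - nu i.

(** Opposite signs attach x and y to opposite ends of the row chain, so the partitions at the middle
    cut of the two words are the two factors on the left of [gkpart_octahedron]. *)
Lemma gkshape_toggle isB up u v x y f i : isB x -> isB y -> up x != up y ->
  let w := u ++ x :: y :: v in
  gkshape isB up (u ++ y :: x :: v) f (size u).+1 i =
  toggle (gkshape isB up w f (size u)) (gkshape isB up w f (size u).+2)
         (gkshape isB up w f (size u).+1) i.
Proof.
move=> Bx By upxy w.
suff : gkshape isB up w f (size u).+1 i + gkshape isB up (u ++ y :: x :: v) f (size u).+1 i =
   maxn (gkshape isB up w f (size u) i) (gkshape isB up w f (size u).+2 i.+1) +
   (if i is i'.+1 then minn (gkshape isB up w f (size u) i') (gkshape isB up w f (size u).+2 i)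
    else gkshape isB up w f (size u).+2 i).
  by rewrite /toggle => <-; rewrite addKn.
rewrite !gkshape_at1 !(colseq_consN _ _ Bx) !(colseq_consN _ _ By).
have e0 j : gkshape isB up w f (size u) j = gkpart (rowseq isB up u) (colseq isB up v) f j.
  by rewrite gkshape_at0 !colseq_consN.
have e2 : gkshape isB up w f (size u).+2 =1 gkpart (rowseq isB up (rcons (rcons u x) y)) (colseq isB up v) f.
  by move=> j; rewrite gkshape_at2.
rewrite !rowseq_rcons // in e2 *.
move: upxy e2; case: (up x); case: (up y) => // _ e2.
  have := gkpart_octahedron y x (rowseq isB up u) (colseq isB up v) f i => /= ->.
  by case: i => [|i]; rewrite !e0 !e2.
have := gkpart_octahedron x y (rowseq isB up u) (colseq isB up v) f i => /=.
rewrite addnC => ->; rewrite rcons_cons in e2.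
by case: i => [|i]; rewrite !e0 !e2.
Qed.

(** The toggle is an involution that preserves interlacing, so both halves carry over by changing
    the one partition between x and y. The pairs of a row letter before a column letter are the same
    for both words. *)
Lemma gkshape_bij_swapB isB up u v x y : isB x -> isB y -> up x != up y ->
  gkshape_bij isB up (u ++ y :: x :: v) -> gkshape_bij isB up (u ++ x :: y :: v).
Proof.
move=> Bx By upxy [surj inj]; set w := u ++ x :: y :: v in surj inj *.
set w' := u ++ y :: x :: v in surj inj *; pose n := size u.
have es : size w' = size w by rewrite !size_cat.
have ne : (isB x, up x) != (isB y, up y) by rewrite xpair_eqE negb_and upxy orbT.
have tw f i := gkshape_toggle u v f i Bx By upxy.
have yx : up y != up x by rewrite eq_sym.
have tw' f i := gkshape_toggle u v f i By Bx yx.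
have n2 : n.+2 <= size w by rewrite size_cat /=; lia.
have sw f m i : m != n.+1 -> gkshape isB up w f m i = gkshape isB up w' f m i.
  by move=> mn; rewrite (gkshape_swap v f ne mn).
split=> [mu ilmu|f g efg].
  pose nu := toggle (mu n) (mu n.+2) (mu n.+1).
  have [_ _ il] := ilmu.
  have ila i : mu n.+1 i.+1 <= mu n i <= mu n.+1 i.
    by have := il n i; rewrite nth_at0 Bx; apply; lia.
  have ilb i : mu n.+2 i.+1 <= mu n.+1 i <= mu n.+2 i.
    by have := il n.+1 i; rewrite nth_at1 By; apply; lia.
  have il' : interlacing isB w' (modify_at n.+1 mu nu).
    apply: interlacing_modify => // i; rewrite ?Bx ?By /nu /toggle -/n.
      have := ila i; have := ilb i; have := ilb i.+1; have := ila i.+1.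
      by case: i => [|i]; [| have := ila i; have := ilb i]; rewrite /=; lia.
    have := ila i; have := ilb i; have := ilb i.+1; have := ila i.+1.
    by case: i => [|i]; [| have := ila i; have := ilb i]; rewrite /=; lia.
  have [f ef] := surj _ il'; exists f => m i mw.
  have [->|mn] := eqVneq m n.+1; last first.
    by rewrite sw // ef ?es // /modify_at (negbTE mn).
  rewrite tw' /toggle !ef ?es; try by lia.
  have ea j : modify_at n.+1 mu nu n j = mu n j by rewrite /modify_at ltn_eqF.
  have eb j : modify_at n.+1 mu nu n.+2 j = mu n.+2 j by rewrite /modify_at gtn_eqF.
  have ec j : modify_at n.+1 mu nu n.+1 j = nu j by rewrite /modify_at eqxx.
  rewrite ec /nu /toggle; have := ila i; have := ilb i; rewrite !ea !eb.
  case: i => [|i]; first by lia.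
  by rewrite !ef ?es ?ea //; [have := ila i; lia | lia].
move=> a b Ba Eb [m [am bm]]; apply: inj => //.
  move=> m' i m'w; have [->|mn] := eqVneq m' n.+1; last by rewrite -!sw // efg -?es.
  rewrite !tw /toggle !efg -/n ?es //; try lia.
  by case: i => [|i] //; rewrite !efg //; lia.
case: (swap_indexP u v x y m) am bm => [mu et ed ed'|em|m' em ed et et'].
- rewrite et ed => am bm; exists m; split => //; rewrite ed'.
  by move: bm; rewrite !mem_cat !inE; case: (_ == x); case: (_ == y).
- rewrite em -/n; have -> : drop n.+1 w = y :: v.
    by rewrite /w -cat_rcons drop_size_cat ?size_rcons.
  have -> : take n.+1 w = rcons u x by rewrite /w -cat_rcons take_size_cat ?size_rcons.
  move=> am; rewrite inE => /predU1P[e|bm]; first by rewrite e By in Eb.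
  exists n.+2; rewrite /w' -!cat_rcons drop_size_cat ?take_size_cat ?size_rcons //; split => //.
  by move: am; rewrite !(mem_rcons, inE) => /orP[->|->]; rewrite ?orbT.
- rewrite et ed => am bm; exists m; split => //; rewrite et'.
  by move: am; rewrite !mem_cat !inE; case: (_ == x); case: (_ == y).
Qed.

Lemma uniq_swap (T : eqType) (u v : seq T) x y : uniq (u ++ x :: y :: v) = uniq (u ++ y :: x :: v).
Proof. by apply: perm_uniq; rewrite perm_cat2l (perm_catCA [:: x] [:: y] v). Qed.

Lemma uniq_rot (T : eqType) (u v t : seq T) x : uniq (u ++ x :: v ++ t) = uniq (u ++ v ++ x :: t).
Proof. by apply: perm_uniq; rewrite perm_cat2l (perm_catCA [:: x] v t). Qed.

(** An up row is last and a down column is last; a down row is first and an up column is first.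
    Opposite signs thus put the cell (x, y) at the maximal or the minimal corner of the grid, where
    the local rule applies; equal signs would put it at one of the other two corners. *)
Lemma gkshape_corner isB up u v x y f : isB x -> ~~ isB y -> up x != up y ->
  let w := u ++ x :: y :: v in let n := size u in
  let a := gkshape isB up w f n in let b := gkshape isB up w f n.+2 in
  gkshape isB up w f n.+1 0 = f x y + maxn (a 0) (b 0) /\
  forall i, gkshape isB up w f n.+1 i.+1 + gkshape isB up (u ++ y :: x :: v) f n.+1 i =
            maxn (a i.+1) (b i.+1) + minn (a i) (b i).
Proof.
move=> Bx Ey upxy w n a b.
have ea j : a j = gkpart (rowseq isB up u) (colseq isB up (y :: v)) f j.
  by rewrite /a gkshape_at0 colseq_consN.
have eb j : b j = gkpart (rowseq isB up (rcons u x)) (colseq isB up v) f j.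
  by rewrite /b gkshape_at2 rowseq_rconsN.
have ec j : gkshape isB up w f n.+1 j = gkpart (rowseq isB up (rcons u x)) (colseq isB up (y :: v)) f j.
  by rewrite gkshape_at1.
have ed j : gkshape isB up (u ++ y :: x :: v) f n.+1 j = gkpart (rowseq isB up u) (colseq isB up v) f j.
  by rewrite gkshape_at1 rowseq_rconsN // colseq_consN.
suff [h1 h2] : gkpart (rowseq isB up (rcons u x)) (colseq isB up (y :: v)) f 0 = f x y + maxn (b 0) (a 0)
   /\ forall i, gkpart (rowseq isB up (rcons u x)) (colseq isB up (y :: v)) f i.+1 +
     gkpart (rowseq isB up u) (colseq isB up v) f i = maxn (b i.+1) (a i.+1) + minn (b i) (a i).
  split=> [|i]; first by rewrite ec h1 maxnC.
  by rewrite ec ed h2 maxnC minnC.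
move: ea eb; rewrite rowseq_rcons // colseq_cons //.
case: (up x) upxy; case: (up y) => // _ ea eb.
  have [h1 h2] := gkpart_corner_last x y (rowseq isB up u) (colseq isB up v) f.
  by split=> [|i]; rewrite !ea !eb.
have [h1 h2] := gkpart_corner_first x y (rowseq isB up u) (colseq isB up v) f.
by split=> [|i]; rewrite !ea !eb.
Qed.

Lemma precedes_index w x y : uniq w -> precedes w x y -> index x w < index y w.
Proof.
move=> uw [m [xm ym]]; rewrite (leq_trans (index_ltn xm)) // leqNgt; apply/negP => lt.
have ymt : y \in take m w by rewrite in_take // -[w](cat_take_drop m) mem_cat ym orbT.
move: uw; rewrite -(cat_take_drop m w) cat_uniq => /and3P[_ /hasPn /(_ _ ym) /negP].
by [].
Qed.

Lemma index_pair u v x y : uniq (u ++ x :: y :: v) ->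
  index x (u ++ x :: y :: v) = size u /\ index y (u ++ x :: y :: v) = (size u).+1.
Proof.
rewrite cat_uniq => /and3P[_ /hasPn h /andP[xy _]].
have xu := h x (mem_head _ _); have yu : y \notin u by apply: h; rewrite !inE eqxx orbT.
move: xy; rewrite inE negb_or => /andP[xy _].
by rewrite !index_cat (negbTE xu) (negbTE yu) /= !eqxx (negbTE xy) addn0 addn1.
Qed.

(** Once y precedes x, the entry [f x y] enters no shape. It can therefore be chosen freely to match
    the largest part at the middle cut, while the other parts at that cut correspond to the
    partition there for the shorter diagram. *)
Lemma gkshape_bij_corner isB up u v x y : isB x -> ~~ isB y -> up x != up y ->
  uniq (u ++ x :: y :: v) ->
  gkshape_bij isB up (u ++ y :: x :: v) -> gkshape_bij isB up (u ++ x :: y :: v).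
Proof.
move=> Bx Ey upxy; set w := u ++ x :: y :: v; set w' := u ++ y :: x :: v.
move=> uw [surj inj]; pose n := size u.
have es : size w' = size w by rewrite !size_cat.
have uw' : uniq w' by rewrite /w' uniq_swap.
have ne : (isB x, up x) != (isB y, up y) by rewrite xpair_eqE negb_and upxy orbT.
have n2 : n.+2 <= size w by rewrite size_cat /=; lia.
have sw f m i : m != n.+1 -> gkshape isB up w f m i = gkshape isB up w' f m i.
  by move=> mn; rewrite (gkshape_swap v f ne mn).
have sc f := gkshape_corner u v f Bx Ey upxy.
split=> [mu ilmu|f g efg].
  pose a := mu n; pose b := mu n.+2; pose c := mu n.+1.
  pose nu i := maxn (a i.+1) (b i.+1) + minn (a i) (b i) - c i.+1.
  have [_ _ il] := ilmu.
  have ila i : c i.+1 <= a i <= c i by have := il n i; rewrite nth_at0 Bx; apply; lia.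
  have ilb i : c i.+1 <= b i <= c i.
    by have := il n.+1 i; rewrite nth_at1 (negbTE Ey); apply; lia.
  have ar a0 a1 b0 b1 c0 c1 c2 : c1 <= a0 <= c0 -> c1 <= b0 <= c0 -> c2 <= a1 <= c1 ->
      c2 <= b1 <= c1 -> (a1 <= maxn a1 b1 + minn a0 b0 - c1 <= a0) &&
      (b1 <= maxn a1 b1 + minn a0 b0 - c1 <= b0) by lia.
  have il' : interlacing isB w' (modify_at n.+1 mu nu).
    apply: interlacing_modify => // i; rewrite ?Bx ?(negbTE Ey) -/n -/a -/b -/c /nu;
    by have /andP[] := ar _ _ _ _ _ _ _ (ila i) (ilb i) (ila i.+1) (ilb i.+1).
  have [f ef] := surj _ il'.
  (* The entry recovered by the local rule; the subtraction is not truncated, since interlacing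
     gives [a 0 <= c 0] and [b 0 <= c 0]. *)
  pose f' p q := if (p == x) && (q == y) then c 0 - maxn (a 0) (b 0) else f p q.
  have ff' m i : gkshape isB up w' f' m i = gkshape isB up w' f m i.
    apply: eq_gkshape => p q _ _ pm qm; rewrite /f'; case: ifP => // /andP[/eqP ep /eqP eq].
    subst p q; exfalso.
    have [ey ex] := index_pair uw'.
    have /(precedes_index uw') : precedes w' x y by exists m.
    by rewrite ey ex ltnNge leqnSn.
  have sf' m i : m <= size w -> gkshape isB up w' f' m i = modify_at n.+1 mu nu m i.
    by move=> mw; rewrite ff' ef // es.
  have sa i : gkshape isB up w f' n i = a i.
    by rewrite sw ?sf' /modify_at ?ltn_eqF //; lia.
  have sb i : gkshape isB up w f' n.+2 i = b i.
    by rewrite sw ?sf' /modify_at ?gtn_eqF //; lia.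
  exists f' => m i mw; have [->|mn] := eqVneq m n.+1; last first.
    by rewrite sw // sf' // /modify_at (negbTE mn).
  have [h0 h] := sc f'; case: i => [|i].
    rewrite h0 sa sb /f' !eqxx /= subnK // geq_max.
    by have /andP[_ ->] := ila 0; have /andP[_ ->] := ilb 0.
  have := h i; rewrite !sa !sb sf' /modify_at ?eqxx //; last by lia.
  have := ila i; have := ilb i; have := ila i.+1; have := ilb i.+1; rewrite /nu -[mu _ _]/(c i.+1).
  by move: (gkshape _ _ _ _ _ _) => d; clearbody a b c; clear; lia.
have [f0 fS] := sc f; have [g0 gS] := sc g.
have n1 := ltnW n2; have n0 := ltnW n1.
have ea i : gkshape isB up w f n i = gkshape isB up w g n i by apply: efg.
have eb i : gkshape isB up w f n.+2 i = gkshape isB up w g n.+2 i by apply: efg.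
have ec i : gkshape isB up w f n.+1 i = gkshape isB up w g n.+1 i by apply: efg.
have fgxy : f x y = g x y by have := ec 0; rewrite f0 g0 ea eb => /addIn.
move=> p q Bp Eq [m [pm qm]].
have [/andP[/eqP-> /eqP->] //|npq] := boolP ((p == x) && (q == y)).
apply: inj => //.
  move=> m' i m'w; have [->|mn] := eqVneq m' n.+1; last by rewrite -!sw // efg -?es.
  by have := fS i; rewrite ec !ea !eb -(gS i) => /addnI.
case: (swap_indexP u v x y m) pm qm => [mu et ed ed'|em|m' em ed et et'].
- rewrite et ed => pm qm; exists m; split => //; rewrite ed'.
  by move: qm; rewrite !mem_cat !inE; case: (q == x); case: (q == y).
- rewrite em -/n; have -> : drop n.+1 w = y :: v.
    by rewrite /w -cat_rcons drop_size_cat ?size_rcons.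
  have -> : take n.+1 w = rcons u x by rewrite /w -cat_rcons take_size_cat ?size_rcons.
  rewrite mem_rcons inE => /predU1P[ep|pu] qm.
    exists n.+2; rewrite /w' -!cat_rcons drop_size_cat ?take_size_cat ?size_rcons //; split.
      by rewrite ep mem_rcons mem_head.
    by move: qm npq; rewrite inE ep eqxx /=; case: (q == y).
  exists n; rewrite /w' drop_size_cat ?take_size_cat //; split => //.
  by move: qm; rewrite !inE; case: (q == y); case: (q == x).
- rewrite et ed => pm qm; exists m; split => //; rewrite et'.
  by move: pm; rewrite !mem_cat !inE; case: (p == x); case: (p == y).
Qed.

Lemma eq_gkshape_bij isB up up' w :
  (forall m, rowseq isB up (take m w) = rowseq isB up' (take m w)) ->
  (forall m, colseq isB up (drop m w) = colseq isB up' (drop m w)) ->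
  gkshape_bij isB up' w -> gkshape_bij isB up w.
Proof.
move=> er ec [surj inj]; have e f m i : gkshape isB up w f m i = gkshape isB up' w f m i.
  by rewrite /gkshape er ec.
split=> [mu /surj[f ef]|f g efg]; first by exists f => m i mw; rewrite e ef.
by apply: inj => m i mw; rewrite -!e efg.
Qed.

(* The first row is alone in the grid when it is added. *)
Lemma gkshape_bij_flip isB up u v x b : all (predC isB) u -> isB x -> uniq (u ++ x :: v) ->
  gkshape_bij isB (fun z => if z == x then b else up z) (u ++ x :: v) ->
  gkshape_bij isB up (u ++ x :: v).
Proof.
move=> uE Bx uw; set up' := fun z => _; apply: eq_gkshape_bij => m; last first.
  rewrite /colseq; congr (_ ++ rev _); apply: eq_filter => z; rewrite /up';
  by case: (z =P x) => // ->; rewrite Bx.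
have fu (a : pred nat) u0 : {subset u0 <= u} -> [seq z <- u0 | isB z && a z] = [::].
  move=> su; rewrite (@eq_in_filter _ _ pred0) ?filter_pred0 // => z /su zu.
  by have /= /negbTE -> := allP uE z zu.
have [le|lt] := leqP m (size u).
  by rewrite takel_cat // /rowseq !fu // => z /mem_take.
have xv : x \notin v by move: uw; rewrite cat_uniq => /and3P[_ _ /andP[]].
have -> : take m (u ++ x :: v) = u ++ x :: take (m - (size u).+1) v.
  by rewrite take_cat ltnNge (ltnW lt) /= -(@prednK (m - size u)) ?subn_gt0 //= subnS.
set v0 := take _ v; have xv0 : x \notin v0 by apply: contra xv => /mem_take.
have fv (a : bool -> bool) : [seq z <- v0 | isB z && a (up z)] = [seq z <- v0 | isB z && a (up' z)].
  by apply: eq_in_filter => z zv; rewrite /up'; case: eqP => // e; rewrite -e zv in xv0.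
have fuu a : [seq z <- u | isB z && a z] = [::] by apply: fu.
have ex : up' x = b by rewrite /up' eqxx.
rewrite /rowseq !filter_cat !fuu /= (fv negb) (fv id) Bx ex; move: (b) => b'.
by case: (up x); case: b' => /=; rewrite ?rev_cons ?cat_rcons.
Qed.

Lemma gkshape_bij_rotB isB up u v t x : isB x -> all (fun z => isB z && (up z != up x)) v ->
  gkshape_bij isB up (u ++ v ++ x :: t) -> gkshape_bij isB up (u ++ x :: v ++ t).
Proof.
move=> Bx; elim: v u => // z v IH u /= /andP[/andP[Bz uz] av].
rewrite -cat_rcons => /IH; rewrite cat_rcons => /(_ av) h.
by apply: gkshape_bij_swapB => //; rewrite eq_sym.
Qed.

(** Column letters can only shrink the partitions and row letters only enlarge them: zero spreads
    from the left end through u and from the right end through v. *)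
Lemma interlacing_eq0 isB u v mu m i : all (predC isB) u -> all isB v ->
  interlacing isB (u ++ v) mu -> m <= size (u ++ v) -> mu m i = 0.
Proof.
move=> uE vB [h0 hs h] mw; have [le|lt] := leqP m (size u).
  elim: m {mw} le i => // m IH le i.
  have := h m i; rewrite nth_cat le.
  have /negbTE -> := allP uE _ (mem_nth 0 le); rewrite !(IH (ltnW le)).
  by rewrite size_cat => /(_ (leq_trans le (leq_addr _ _))); lia.
move: mw; move: {2}(size (u ++ v) - m) (erefl (size (u ++ v) - m)) => d.
elim: d m lt i => [|d IH] m lt i ed mw; first by have -> : m = size (u ++ v) by lia.
have mw' : m < size (u ++ v) by lia.
have := h m i mw'; rewrite nth_cat ltnNge (ltnW lt) /=.
have -> : isB (nth 0 v (m - size u)).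
  by apply: (allP vB); apply: mem_nth; rewrite -(ltn_add2l (size u)) subnKC ?(ltnW lt) // -size_cat.
have IHm j : mu m.+1 j = 0 by apply: IH => //; [apply: ltnW | rewrite subnS ed].
by rewrite !IHm leqn0 => /eqP.
Qed.

Lemma gkshape_bij_sorted isB up u v : all (predC isB) u -> all isB v ->
  gkshape_bij isB up (u ++ v).
Proof.
move=> uE vB; split=> [mu ilmu|f g _ x y Bx Ey [m [xm ym]]].
  exists (fun _ _ => 0) => m i mw; rewrite (interlacing_eq0 i uE vB ilmu) //.
  exact: (interlacing_eq0 i uE vB (gkshape_interlacing _ _ _ _)).
have [le|lt] := leqP m (size u).
  by have := allP uE x; rewrite takel_cat // in xm; move/(_ (mem_take xm)); rewrite /= Bx.
move: ym; rewrite drop_cat ltnNge (ltnW lt) /= => /mem_drop /(allP vB) By.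
by rewrite By in Ey.
Qed.

(** Pairs of a row letter before a column letter, that is, the boxes of the diagram coded by the
    word. *)
Fixpoint inversions (isB : pred nat) w : nat :=
  if w is x :: w' then (if isB x then count (predC isB) w' else 0) + inversions isB w' else 0.

Lemma inversions_swap isB u v x y : isB x -> ~~ isB y ->
  inversions isB (u ++ y :: x :: v) < inversions isB (u ++ x :: y :: v).
Proof.
move=> Bx Ey; elim: u => [|z u IH] /=; first by rewrite Bx (negbTE Ey) /=; lia.
have -> : count (predC isB) (u ++ x :: y :: v) = count (predC isB) (u ++ y :: x :: v).
  by rewrite !count_cat /=; congr (_ + _); apply: addnCA.
by rewrite ltn_add2l.
Qed.

Lemma inversions_rot isB u v t x : isB x -> all isB v ->
  inversions isB (u ++ v ++ x :: t) = inversions isB (u ++ x :: v ++ t).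
Proof.
move=> Bx; elim: v u => // z v IH u /= /andP[Bz av].
rewrite -cat_rcons IH // cat_rcons; elim: u => [|z' u IHu] /=; first by rewrite Bx Bz /=; lia.
by rewrite IHu; congr ((if _ then _ else _) + _); rewrite !count_cat /=; congr (_ + _); apply: addnCA.
Qed.

Lemma first_corner isB w :
  (exists u v, [/\ w = u ++ v, all (predC isB) u & all isB v]) \/
  (exists u b y t, [/\ w = u ++ b ++ y :: t, all (predC isB) u, all isB b, b != [::] & ~~ isB y]).
Proof.
elim: w => [|z w IH]; first by left; exists [::], [::].
case: IH => [[u [v [-> uE vB]]]|[u [b [y [t [-> uE bB b0 Ey]]]]]].
  have [Bz|Ez] := boolP (isB z); last by left; exists (z :: u), v; rewrite /= Ez.
  case: u uE => [|e u] /=; first by left; exists [::], (z :: v); rewrite /= Bz.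
  by move=> /andP[Ee uE]; right; exists [::], [:: z], e, (u ++ v); rewrite /= Bz.
have [Bz|Ez] := boolP (isB z); last by right; exists (z :: u), b, y, t; rewrite /= Ez.
case: u uE => [|e u] /=; first by right; exists [::], (z :: b), y, t; rewrite /= Bz.
by move=> /andP[Ee uE]; right; exists [::], [:: z], e, (u ++ b ++ y :: t); rewrite /= Bz.
Qed.

Lemma last_failure (T : Type) (P : pred T) (b : seq T) :
  all P b \/ exists b1 x b2, [/\ b = b1 ++ x :: b2, ~~ P x & all P b2].
Proof.
elim: b => [|z b [Pb|[b1 [x [b2 [-> h1 h2]]]]]]; first by left.
  by have [Pz|nPz] := boolP (P z); [left; rewrite /= Pz | right; exists [::], z, b].
by right; exists (z :: b1), x, b2.
Qed.

Theorem gkshape_bijective isB up w : uniq w -> gkshape_bij isB up w.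
Proof.
have [n] := ubnP (inversions isB w); elim: n up w => // n IH up w ltn uw.
case: (first_corner isB w) => [[u [v [-> uE vB]]]|[u [b [y [t [ew uE bB b0 Ey]]]]]].
  exact: gkshape_bij_sorted.
(* The letters of [b2] have the sign of y, opposite to that of x, so x can pass through them and
   stand next to y. This preserves the inversions, and removing the corner then lowers them. The
   signs [up'] are arbitrary because one case below changes them. *)
have step up' b1 x b2 : b = b1 ++ x :: b2 -> up' x != up' y ->
    all (fun z => up' z == up' y) b2 -> gkshape_bij isB up' w.
  move=> eb ux ab; move: bB; rewrite eb all_cat /= => /and3P[b1B Bx b2B].
  have ew' : w = (u ++ b1) ++ x :: b2 ++ y :: t by rewrite ew eb -!catA.
  rewrite ew'; apply: gkshape_bij_rotB => //.
    apply/allP => z zb; rewrite (allP b2B z zb) /=.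
    by rewrite (eqP (allP ab z zb)) eq_sym.
  rewrite catA; apply: gkshape_bij_corner => //.
    by rewrite -catA -(uniq_rot (u ++ b1) b2 (y :: t) x) -ew'.
  apply: IH.
    rewrite -ltnS; apply: leq_trans ltn; rewrite ew' -(inversions_rot _ _ Bx b2B) catA ltnS.
    exact: inversions_swap.
  by rewrite -(uniq_swap ((u ++ b1) ++ b2) t x y) -(catA (u ++ b1)) -(uniq_rot (u ++ b1) b2 (y :: t) x) -ew'.
(* The last letter of the run whose sign differs from that of y is the one to move. If there is
   none, the first letter of the run, which is the first row letter of the word, receives the
   opposite sign. *)
have [ab|[b1 [x [b2 [eb /= nx ab]]]]] := last_failure (fun z => up z == up y) b; last exact: step eb nx ab.
case: b b0 bB ew ab step => // x b _ bB ew /= /andP[/eqP ux ab] step.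
have Bx : isB x by case/andP: bB.
have uw' := uw; rewrite ew /= in uw' *; apply: (@gkshape_bij_flip _ _ _ _ _ (~~ up y)) => //.
rewrite -ew; have xnot : x \notin b ++ y :: t.
  by move: uw'; rewrite cat_uniq => /and3P[_ _ /andP[]].
have yx : (y == x) = false.
  by apply/negbTE/eqP => e; rewrite -e mem_cat mem_head orbT in xnot.
apply: (step _ [::] x b) => //; first by rewrite eqxx yx; case: (up y).
apply/allP => z zb; rewrite yx.
have /negbTE -> : z != x by apply: contra xnot => /eqP <-; rewrite mem_cat zb.
exact: (allP ab z zb).
Qed.

End Words.

(** * The Auslander-Reiten quiver as a grid *)

Lemma GK_M_unique (T : eqType) (vs : seq T) e w k m :
  (k = 0 -> m = 0) -> (0 < k -> is_max_wt vs e w k m) -> GK_M vs e w k = m.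
Proof.
case: k => [h0 _|k _ /(_ isT) H]; first by rewrite h0.
rewrite /GK_M; have := epsilon_spec (inhabits 0) _ (ex_intro _ m H).
move: (epsilon _ _) => m' [[gs' [s1 p1 e1]] b1].
case: H => [[gs [s2 p2 e2]] b2].
by apply/eqP; rewrite eqn_leq -{1}e1 -{2}e2 b1 ?b2.
Qed.

Definition gridstep (u v : nat * nat) : bool :=
  ((v.1 == u.1.+1) && (v.2 == u.2)) || ((v.1 == u.1) && (v.2 == u.2.+1)).

(** The lattice path that enters column c in row [J c] and leaves it in row [J c.+1], for n columns
    starting at d. *)
Definition staircase (J : nat -> nat) (d n : nat) : seq (nat * nat) :=
  flatten [seq [seq (x, c) | x <- iota (J c) (J c.+1 - J c).+1] | c <- iota d n].

Lemma mem_staircase J d n x c :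
  ((x, c) \in staircase J d n) = (d <= c < d + n) && (J c <= x <= maxn (J c) (J c.+1)).
Proof.
apply/flattenP/andP => [[s /mapP[c']]|[cd xJ]].
  by rewrite mem_iota => cd -> /mapP[x']; rewrite mem_iota => xJ [-> ->]; lia.
exists [seq (x, c) | x <- iota (J c) (J c.+1 - J c).+1].
  by apply/mapP; exists c; rewrite ?mem_iota.
by apply/mapP; exists x; rewrite ?mem_iota //; lia.
Qed.

Lemma staircase_path J d n : (forall c, J c <= J c.+1) ->
  exists s, staircase J d n.+1 = (J d, d) :: s /\ path gridstep (J d, d) s.
Proof.
move=> mJ; have col x c m : path gridstep (x, c) [seq (y, c) | y <- iota x.+1 m] /\
    last (x, c) [seq (y, c) | y <- iota x.+1 m] = (x + m, c).
  elim: m x => [|m IH] x; first by rewrite addn0.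
  by have [h1 h2] := IH x.+1; rewrite /= h1 h2 /gridstep /= !eqxx addSnnS.
elim: n d => [|n IH] d.
  exists [seq (y, d) | y <- iota (J d).+1 (J d.+1 - J d)]; rewrite /staircase /= cats0.
  by split => //; have [] := col (J d) d (J d.+1 - J d).
have [s [es ps]] := IH d.+1.
exists ([seq (y, d) | y <- iota (J d).+1 (J d.+1 - J d)] ++ (J d.+1, d.+1) :: s).
split; first by rewrite -es.
have [h1 h2] := col (J d) d (J d.+1 - J d).
by rewrite cat_path h1 h2 /= ps subnKC // /gridstep /= !eqxx orbT.
Qed.

Lemma sorted_comparable (T : eqType) (r : rel T) (p : seq T) x y :
  transitive r -> reflexive r -> sorted r p -> x \in p -> y \in p -> r x y || r y x.
Proof.
move=> tr rr sp xp yp; rewrite -(nth_index x xp) -[y](nth_index x yp).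
have [le|le] := leqP (index x p) (index y p); apply/orP; [left | right];
  by apply: sorted_leq_nth; rewrite ?inE ?index_mem // ltnW.
Qed.

Section GridDigraph.

Variables (vs : seq (nat * nat)) (e : rel (nat * nat)) (s t : seq nat).
Hypotheses (us : uniq s) (ut : uniq t).
Hypothesis memvs : forall v, (v \in vs) = (v.1 \in s) && (v.2 \in t).
Hypothesis edgeE : {in vs &, forall u v,
  e u v = gridstep (index u.1 s, index u.2 t) (index v.1 s, index v.2 t)}.

Let p := size s.
Let q := size t.
Let cell (x : nat * nat) : nat * nat := (nth 0 s x.1, nth 0 t x.2).
Let ocell (x : 'I_p * 'I_q) : nat * nat := cell (val x.1, val x.2).

Lemma ocell_inj : injective ocell.
Proof.
move=> [a b] [c d] [] /eqP e1 /eqP e2; rewrite !nth_uniq // in e1 e2.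
by rewrite (val_inj (eqP e1)) (val_inj (eqP e2)).
Qed.

Lemma ocell_mem x : ocell x \in vs.
Proof. by rewrite memvs !mem_nth /= ?ltn_ord. Qed.

Lemma tuple_wt_grid w gs : tuple_wt vs w gs =
  \sum_(x in [set x | has (fun g => ocell x \in g) gs]) w (ocell x).
Proof.
have pm : perm_eq (undup vs) [seq ocell x | x <- enum [set: 'I_p * 'I_q]].
  apply: uniq_perm; rewrite ?undup_uniq ?map_inj_uniq ?enum_uniq //; first exact: ocell_inj.
  move=> v; rewrite mem_undup; apply/idP/mapP => [|[x _ ->]]; last exact: ocell_mem.
  rewrite memvs => /andP[v1 v2].
  have i1 : index v.1 s < p by rewrite index_mem.
  have i2 : index v.2 t < q by rewrite index_mem.
  exists (Ordinal i1, Ordinal i2); first by rewrite mem_enum inE.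
  by rewrite /ocell /cell /= !nth_index // -surjective_pairing.
rewrite /tuple_wt (perm_big _ pm) /= big_map big_enum_cond /=.
by apply: eq_bigl => x; rewrite !inE.
Qed.

Lemma path_comparable g x y : is_path_in vs e g ->
  ocell x \in g -> ocell y \in g -> gridcmp x y.
Proof.
case: g => // v g /andP[avs pg] xg yg.
pose r := [rel a b : nat * nat | (index a.1 s <= index b.1 s) && (index a.2 t <= index b.2 t)].
have tr : transitive r.
  by move=> b a c /andP[h1 h2] /andP[h3 h4]; rewrite /r /= (leq_trans h1) ?(leq_trans h2).
have rr : reflexive r by move=> a; rewrite /r /= !leqnn.
have sg : sorted r (v :: g).
  apply: (sub_in_path (P := mem vs) (e := e)) avs pg => a b av bv.
  by rewrite edgeE // /gridstep /=; lia.
have := sorted_comparable tr rr sg xg yg.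
by rewrite /r /= !index_uniq.
Qed.

(** Arrows increase one index, so vertices on one path are comparable. Sending a vertex to the first
    path through it is then injective on antichains. *)
Lemma grid_weight_le w k gs : size gs = k -> all (is_path_in vs e) gs ->
  tuple_wt vs w gs <= gkseq s t (fun x y => w (x, y)) k.
Proof.
move=> sg pg; rewrite tuple_wt_grid.
apply: (@gkmax_ge _ (@gridcmp p q) (fun x => w (ocell x)) k).
apply/width_leP => V sV aV.
have [V0|[x0 x0V]] := set_0Vmem V; first by rewrite V0 cards0.
have hasV x : x \in V -> has (fun g => ocell x \in g) gs.
  by move=> /(subsetP sV); rewrite inE.
have k0 : 0 < k by rewrite -sg; case: (gs) (hasV _ x0V).
pose rho x : 'I_k.-1.+1 := inord (find (fun g => ocell x \in g) gs).
have rhoE x : x \in V -> rho x = find (fun g => ocell x \in g) gs :> nat.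
  by move=> xV; rewrite inordK // prednK // -sg -has_find; apply: hasV.
rewrite -(card_in_imset (f := rho)).
  by rewrite -[X in _ <= X](prednK k0) -[X in _ <= X]card_ord max_card.
move=> x y xV yV exy; apply: (antichainP _ _ aV) => //.
have hx := nth_find [::] (hasV _ xV); have hy := nth_find [::] (hasV _ yV).
apply: (@path_comparable (nth [::] gs (rho x))).
- by apply: (allP pg); rewrite mem_nth // rhoE // -has_find; apply: hasV.
- by rewrite rhoE.
- by rewrite exy rhoE.
Qed.

Lemma staircase_is_path J : 0 < q -> (forall c, J c <= J c.+1) -> (forall c, J c < p) ->
  is_path_in vs e [seq cell x | x <- staircase J 0 q].
Proof.
move=> q0 mJ bJ; have [g [eg pg]] := staircase_path 0 q.-1 mJ.
have bnd a c : (a, c) \in staircase J 0 q -> (a < p) && (c < q).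
  rewrite mem_staircase => /andP[/andP[_ ->]]; have := bJ c; have := bJ c.+1; rewrite /=; lia.
have inv v : v \in staircase J 0 q -> cell v \in vs.
  by case: v => a c /bnd /andP[h1 h2]; rewrite memvs !mem_nth.
rewrite (prednK q0) in eg; rewrite /is_path_in eg map_cons -map_cons -eg.
apply/andP; split; first by apply/allP => _ /mapP[v vJ ->]; apply: inv.
rewrite path_map.
apply: (sub_in_path (P := mem (staircase J 0 q)) (e := gridstep)) pg; last by rewrite eg; apply/allP.
move=> [a c] [b d] ha hb hs; rewrite /= edgeE ?inv //.
by have /andP[? ?] := bnd _ _ ha; have /andP[? ?] := bnd _ _ hb; rewrite /= !index_uniq.
Qed.

(** Quiver paths may overlap and may start and end anywhere, so the level lines of [layer U] serve
    without boundary terms. They are capped at row p-1 because [level] returns p when the height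
    stays too small. *)
Lemma grid_weight_ex w k : 0 < p -> 0 < q ->
  exists gs, [/\ size gs = k, all (is_path_in vs e) gs &
    gkseq s t (fun x y => w (x, y)) k <= tuple_wt vs w gs].
Proof.
move=> p0 q0; have [U wU eU] := gkmax_ex (@gridcmp p q) (fun x => w (ocell x)) k.
pose J r c := minn p.-1 (level p (layer U) c r).
have mH c : {homo (layer U)^~ c : i j / i <= j} by move=> i j ij; apply: layer_mono.
have lvl c r i : i < p -> (level p (layer U) c r <= i) = (r < layer U i.+1 c).
  by move=> ip; apply: level_le.
have bJ r c : J r c < p by rewrite /J; lia.
have mJ r c : J r c <= J r c.+1.
  rewrite /J leq_min geq_minl /=.
  have [lt|le] := ltnP (level p (layer U) c.+1 r) p; last by rewrite geq_min; lia.
  apply: leq_trans (geq_minr _ _) _; rewrite lvl //.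
  by apply: leq_trans (layer_mono U (leqnn _) (leqnSn c)); rewrite -lvl.
exists [seq [seq cell x | x <- staircase (J r) 0 q] | r <- iota 0 k]; split.
- by rewrite size_map size_iota.
- by apply/allP => _ /mapP[r _ ->]; apply: staircase_is_path.
rewrite tuple_wt_grid (_ : gkseq _ _ _ _ = \sum_(x in U) w (ocell x)); last exact: eU.
rewrite big_mkcond [X in _ <= X]big_mkcond /=; apply: leq_sum => x _.
case: ifP => // xU; rewrite ifT // inE; have [h1 h2] := layer_cover xU wU.
apply/hasP; exists [seq cell y | y <- staircase (J (layer U x.1 x.2.+1)) 0 q].
  by apply/mapP; exists (layer U x.1 x.2.+1); rewrite ?mem_iota.
apply: map_f; rewrite mem_staircase /= ltn_ord /=.
have lx := ltn_ord x.1.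
have l1 : level p (layer U) x.2 (layer U x.1 x.2.+1) <= x.1 by rewrite lvl.
have l2 : x.1 <= level p (layer U) x.2.+1 (layer U x.1 x.2.+1).
  case E : (x.1 : nat) => [|i] //; rewrite ltnNge lvl -?leqNgt; last by apply: ltn_trans lx; rewrite E.
  exact: leqnn.
rewrite /J; move: l1 l2 lx; move: (level _ _ _ _) (level _ _ _ _) => a b; move: (x.1 : nat) => c.
clear; lia.
Qed.

Lemma GK_M_grid w k : 0 < p -> 0 < q ->
  GK_M vs e w k = gkseq s t (fun x y => w (x, y)) k.
Proof.
move=> p0 q0; apply: GK_M_unique => [->|_]; first exact: gkseq0.
split; last by move=> gs sg pg; apply: grid_weight_le.
have [gs [sg pg le]] := grid_weight_ex w k p0 q0; exists gs; split=> //.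
by apply/eqP; rewrite eqn_leq le andbT; apply: grid_weight_le.
Qed.

End GridDigraph.

(** * The cycle of a Coxeter element *)

Definition swap (i k : nat) : nat := if k == i then i.+1 else if k == i.+1 then i else k.
(** A left fold, because a product of permutations applies its left factor first. *)
Definition swaps (o : seq nat) (k : nat) : nat := foldl (fun k i => swap i k) k o.

Lemma permappM n (s t : {perm 'I_n}) k : permapp (s * t)%g k = permapp t (permapp s k).
Proof.
case: k => //= k; case: insubP => [x kn ex|nk] /=; last by rewrite insubN.
by rewrite valK permM.
Qed.

Lemma permapp1 n k : permapp (1 : {perm 'I_n})%g k = k.
Proof. by case: k => //= k; case: insubP => // x _ <-; rewrite perm1. Qed.

Lemma permapp_sgen n i k : 0 < i < n -> permapp (sgen n i) k = swap i k.
Proof.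
case: i => // i /= lt; rewrite /sgen /= (insubT (fun j => j < n) (ltnW lt)) (insubT (fun j => j < n) lt) /=.
set a := Sub i _; set b := Sub i.+1 _.
case: k => [|k] //=; rewrite /swap !eqSS.
case: insubP => [x kn ex|].
  have [ek|ki] := eqVneq k i.
    by rewrite (_ : x = a) ?tpermL //; apply: val_inj; rewrite ex.
  have [ek|ki'] := eqVneq k i.+1.
    by rewrite (_ : x = b) ?tpermR //; apply: val_inj; rewrite ex.
  by rewrite tpermD ?ex // -val_eqE /= ex eq_sym.
rewrite -leqNgt => nk; rewrite !gtn_eqF //; lia.
Qed.

Lemma permapp_prod n o k : {subset o <= iota 1 n.-1} ->
  permapp (\prod_(i <- o) sgen n i)%g k = swaps o k.
Proof.
elim: o k => [|i o IH] k so; first by rewrite big_nil permapp1.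
rewrite big_cons permappM permapp_sgen ?IH //.
  by move=> j jo; apply: so; rewrite inE jo orbT.
by have := so i (mem_head _ _); rewrite mem_iota; lia.
Qed.

(* For [1 < k <= n], a Coxeter element [c] with reduced word [o] satisfies [k < c k] iff [o]
   has [k] before [k.-1]; [index] makes 1 rise and n fall. *)
Definition rises (o : seq nat) (k : nat) : bool := index k o < index k.-1 o.
Definition coxcycle (up : pred nat) (s : seq nat) : seq nat :=
  rev [seq x <- s | ~~ up x] ++ [seq x <- s | up x].

Lemma swaps_cat o1 o2 k : swaps (o1 ++ o2) k = swaps o2 (swaps o1 k).
Proof. exact: foldl_cat. Qed.

Lemma swaps_comm o n k : {in o, forall i, i.+1 < n} -> swaps o (swap n k) = swap n (swaps o k).
Proof.
elim: o k => //= i o IH k H; rewrite -IH => [|j jo]; last by apply: H; rewrite inE jo orbT.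
congr (swaps o _); have := H i (mem_head _ _); rewrite /swap.
by repeat case: ifP; lia.
Qed.

Lemma swaps_fix o k : {in o, forall i, i.+1 < k} -> swaps o k = k.
Proof.
elim: o => //= i o IH H; have lt := H i (mem_head _ _).
rewrite /swap !gtn_eqF //; last exact: ltnW.
by apply: IH => j jo; apply: H; rewrite inE jo orbT.
Qed.

Lemma iota1S n : iota 1 n.+1 = rcons (iota 1 n) n.+1.
Proof. by rewrite -[n.+1 in LHS]addn1 iotaD cats1 add1n. Qed.

Lemma sub_path_target (T : eqType) (e e' : rel T) x p :
  (forall a b, b \in p -> e a b -> e' a b) -> path e x p -> path e' x p.
Proof.
elim: p x => //= y p IH x H /andP[xy yp]; rewrite H ?mem_head //=.
by apply: IH yp => a b bp; apply: H; rewrite inE bp orbT.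
Qed.

(** Induction removing the largest generator from the word. It commutes with all the others except
    its predecessor, so it can be moved to one end of the word, and multiplying by it there inserts
    n+2 next to n+1 in the cycle. *)
Lemma coxeter_cycle n o : uniq o -> o =i iota 1 n -> fcycle (swaps o) (coxcycle (rises o) (iota 1 n.+1)).
Proof.
elim: n o => [|n IH] o uo mo.
  have -> : o = [::] by case: o uo mo => // x o _ /(_ x); rewrite mem_head.
  by [].
have no : n.+1 \in o by rewrite mo mem_iota; lia.
case/splitPr: no uo mo => o1 o2 uo mo {o}.
have no1 : n.+1 \notin o1.
  by move: uo; rewrite cat_uniq => /and3P[_ /norP[]].
have no2 : n.+1 \notin o2.
  by move: uo; rewrite cat_uniq => /and3P[_ _ /andP[]].
have u12 : uniq (o1 ++ o2).
  by move: uo; rewrite !cat_uniq /= => /and3P[-> /norP[_ ->] /andP[_ ->]].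
have m12 : o1 ++ o2 =i iota 1 n.
  move=> x; have [->|xn] := eqVneq x n.+1.
    by rewrite mem_cat (negbTE no1) (negbTE no2) mem_iota; lia.
  by have := mo x; rewrite !mem_cat inE (negbTE xn) orFb => ->; rewrite !mem_iota; lia.
have := IH _ u12 m12; set o := o1 ++ n.+1 :: o2 in uo mo *; set o' := o1 ++ o2 in u12 m12 *.
have idx x y : x \in o' -> y != n.+1 -> (index x o' < index y o') = (index x o < index y o).
  move=> xo yn; have xn : x != n.+1.
    by apply: contraTneq xo => ->; rewrite m12 mem_iota; lia.
  rewrite /o /o' !index_cat /= ![n.+1 == _]eq_sym (negbTE xn) (negbTE yn).
  have := index_mem x o1; have := index_mem y o1.
  move: (index x o1) (index y o1) (index x o2) (index y o2) (size o1) => i1 i2 i3 i4 l.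
  by clear; case: (x \in o1); case: (y \in o1); lia.
have upE k : 0 < k <= n -> rises o' k = rises o k.
  by move=> kn; apply: idx; [rewrite m12 mem_iota; lia | lia].
have nno : n.+2 \notin o by rewrite mo mem_iota; lia.
have up2 : rises o n.+2 = false.
  by rewrite /rises /= [index n.+2 o]memNindex // ltnNge index_size.
have up2' : rises o' n.+1 = false.
  by rewrite /rises memNindex ?ltnNge ?index_size // m12 mem_iota; lia.
have eZ : [seq x <- iota 1 n | rises o' x] = [seq x <- iota 1 n | rises o x].
  by apply: eq_in_filter => x; rewrite mem_iota => xn; apply: upE; lia.
have eZ' : [seq x <- iota 1 n | ~~ rises o' x] = [seq x <- iota 1 n | ~~ rises o x].
  by apply: eq_in_filter => x; rewrite mem_iota => xn; rewrite upE //; lia.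
pose Z := rev [seq x <- iota 1 n | ~~ rises o x] ++ [seq x <- iota 1 n | rises o x].
have eT' : coxcycle (rises o') (iota 1 n.+1) = n.+1 :: Z.
  by rewrite /coxcycle !iota1S !filter_rcons up2' /= rev_rcons eZ eZ'.
have eT : coxcycle (rises o) (iota 1 n.+2) =
    n.+2 :: (if rises o n.+1 then rcons Z n.+1 else n.+1 :: Z).
  rewrite /coxcycle !iota1S !filter_rcons up2 /= rev_rcons.
  by case: (rises o n.+1); rewrite /= ?rev_rcons -?rcons_cat.
rewrite eT eT'.
have mZ z : z \in Z -> 0 < z <= n.
  by rewrite mem_cat mem_rev !mem_filter mem_iota => /orP[] /andP[_]; lia.
have fx : swaps o' n.+2 = n.+2.
  by apply: swaps_fix => i; rewrite m12 mem_iota; lia.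
have [up|dn] := boolP (rises o n.+1).
  (* Here n+1 precedes n in the word, so the generator moves to the front and n+2 is inserted right
     after n+1. *)
  have sE k : swaps o k = swaps o' (swap n.+1 k).
    rewrite /o /o' !swaps_cat /=; congr (swaps o2 _); rewrite swaps_comm // => i io.
    have : i \in o' by rewrite /o' mem_cat io.
    rewrite m12 mem_iota => lt; suff : i != n by lia.
    apply: contraTneq up => ein; have nio : n \in o1 by rewrite -ein.
    rewrite /rises /o !index_cat (negbTE no1) /= eqxx nio addn0.
    by rewrite -leqNgt ltnW // index_mem.
  have sZ z : z \in Z -> swaps o z = swaps o' z.
    by move=> /mZ zn; rewrite sE /swap !ltn_eqF //; lia.
  rewrite /= !rcons_path last_rcons /=.
  have -> : swaps o n.+1 = n.+2 by rewrite sE /swap eqxx.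
  have sn2 : swaps o n.+2 = swaps o' n.+1 by rewrite sE /swap eqxx gtn_eqF.
  rewrite eqxx andbT => /andP[].
  case: Z mZ sZ {eT eT'} => [|z Z] mZ sZ /=.
    by rewrite sn2 => _ ->.
  move=> /andP[pz pZ] pl; rewrite sn2 pz /=.
  have sub : {in z :: Z &, forall a b, frel (swaps o') a b -> frel (swaps o) a b}.
    by move=> a b aZ _ /=; rewrite sZ.
  rewrite (sub_in_path sub _ pZ) ?sZ ?mem_last //; exact/allP.
(* Here n precedes n+1, so the generator moves to the back and n+2 is inserted right before n+1. *)
have sE k : swaps o k = swap n.+1 (swaps o' k).
  rewrite /o /o' !swaps_cat /= swaps_comm // => i io.
  have : i \in o' by rewrite /o' mem_cat io orbT.
  rewrite m12 mem_iota => lt; suff : i != n by lia.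
  apply: contraNneq dn => ein; rewrite /rises /o !index_cat (negbTE no1) /= eqxx addn0.
  have nno1 : n \notin o1.
    apply/negP => h; move: u12; rewrite /o' cat_uniq => /and3P[_ /hasPn /(_ i io)].
    by rewrite ein h.
  by rewrite (negbTE nno1) /= gtn_eqF // addnS ltnS leq_addr.
have s1 z : swaps o' z != n.+1 -> swaps o' z != n.+2 -> swaps o z = swaps o' z.
  by move=> h1 h2; rewrite sE /swap (negbTE h1) (negbTE h2).
have s2 z : swaps o' z = n.+1 -> swaps o z = n.+2.
  by move=> h1; rewrite sE /swap h1 eqxx.
have s0 : swaps o n.+2 = n.+1 by rewrite sE fx /swap gtn_eqF // eqxx.
rewrite /= s0 eqxx /= !rcons_path /= => /andP[pZ /eqP pl].
rewrite (s2 _ pl) eqxx andbT.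
apply: (sub_path_target _ pZ) => a b /mZ bn /eqP ab; rewrite /= s1 ?ab //; lia.
Qed.

Lemma gkseq_filter_rows (a : pred nat) s t f k :
  (forall x y, x \in s -> y \in t -> ~~ a x -> f x y = 0) ->
  gkseq [seq x <- s | a x] t f k = gkseq s t f k.
Proof.
move=> f0; pose I := [seq i <- iota 0 (size s) | a (nth 0 s i)].
have eI : [seq x <- s | a x] = [seq nth 0 s i | i <- I].
  by rewrite -[X in filter a X](@mkseq_nth _ 0) /mkseq filter_map.
have sI : size [seq x <- s | a x] = size I by rewrite eI size_map.
have mI i : i < size I -> nth 0 I i < size s.
  by move=> /(mem_nth 0); rewrite mem_filter mem_iota => /and3P[].
have srt : sorted ltn I by apply: sorted_filter (iota_ltn_sorted _ _); apply: ltn_trans.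
rewrite /gkseq sI; apply: (@gkgrid_emb _ _ _ _ _ _ _ (nth 0 I) id) => //.
- move=> i j ip jp; rewrite leqNgt [RHS]leqNgt; congr (~~ _).
  have [lt|ge] := ltnP j i.
    by rewrite (sorted_ltn_nth ltn_trans 0 srt).
  rewrite ltnNge; apply/negbTE; rewrite negbK.
  by apply: (sorted_leq_nth leq_trans leqnn 0 _) => //; apply: sub_sorted srt => ? ?; apply: ltnW.
- by move=> i j ip jp; rewrite eI (nth_map 0).
- move=> i j ip jp no; apply: f0; rewrite ?mem_nth //; apply/negP => ai; apply: no.
  have iI : i \in I by rewrite mem_filter ai mem_iota.
  by exists (index i I), j; rewrite index_mem iI nth_index.
Qed.

(** Cuts the grid on all letters down to the B rows and E columns, which carry the filling. *)
Lemma gkseq_filter (a b : pred nat) s t f k :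
  (forall x y, ~~ (a x && b y) -> f x y = 0) ->
  gkseq [seq x <- s | a x] [seq y <- t | b y] f k = gkseq s t f k.
Proof.
move=> f0; rewrite gkseq_filter_rows => [|x y _ _ ax]; last by apply: f0; rewrite (negbTE ax).
rewrite !(gkseq_tr s) gkseq_filter_rows // => x y _ _ bx.
by apply: f0; rewrite (negbTE bx) andbF.
Qed.

(** Since [t] is nonempty, the last element of [s] is sent into [t] and the arc [s] does not close
    up on itself. *)
Lemma fcycle_index (f : nat -> nat) s t a b : fcycle f (s ++ t) -> uniq (s ++ t) ->
  0 < size t -> a \in s -> b \in s -> (b == f a) = (index b s == (index a s).+1).
Proof.
move=> cy us t0 sa bs; case/splitPr: sa bs cy us => s1 s2 bs cy us.
have cy' : fcycle f (a :: s2 ++ t ++ s1).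
  by rewrite -(rot_cycle (size s1)) -catA rot_size_cat /= -catA in cy.
move: us; rewrite cat_uniq => /and3P[us /hasPn ht _].
have us2 := us; move: us2; rewrite cat_uniq => /and3P[_ /norP[as1 _] /andP[as2 _]].
rewrite [index a _]index_cat (negbTE as1) /= eqxx addn0.
case: s2 bs us ht cy' as2 {cy} => [|z s2] bs us ht cy' as2.
  case: t t0 ht cy' => // y t _ ht /= /andP[/eqP -> _].
  have -> : (b == y) = false.
    by apply: contraNF (ht y (mem_head _ _)) => /eqP <-.
  apply/esym; have := bs; rewrite -index_mem size_cat /= addn1.
  by move: (index b _) => i; lia.
have ez : f a = z by move: cy' => /= /andP[/eqP].
have iz : index z (s1 ++ a :: z :: s2) = (size s1).+1.
  have zs1 : z \notin s1.
    move: us; rewrite cat_uniq => /and3P[_ /hasPn h _].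
    by apply: h; rewrite !inE eqxx orbT.
  rewrite index_cat (negbTE zs1) /=; move: as2; rewrite inE negb_or => /andP[/negbTE -> _].
  by rewrite eqxx addn1.
rewrite ez -iz; apply/eqP/eqP => [->//|e].
have zs : z \in s1 ++ a :: z :: s2 by rewrite mem_cat !inE eqxx !orbT.
by rewrite -(nth_index 0 bs) e nth_index.
Qed.

Lemma coxeter_permapp n (c : {perm 'I_n}) : 0 < n -> coxeter c ->
  exists up, fcycle (permapp c) (coxcycle up (iota 1 n)).
Proof.
case: n c => // n c _ [o [po ->]]; exists (rises o).
have uo : uniq o by rewrite (perm_uniq po) iota_uniq.
have e : permapp (\prod_(i <- o) sgen n.+1 i)%g =1 swaps o.
  by move=> k; apply: permapp_prod => x; rewrite (perm_mem po).
by rewrite (eq_fcycle e); apply: coxeter_cycle uo (perm_mem po).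
Qed.

Section ARGrid.

Variables (n m : nat) (c : {perm 'I_n}) (up : pred nat).
Hypothesis cyc : fcycle (permapp c) (coxcycle up (iota 1 n)).
Hypotheses (m0 : 0 < m) (mn : m < n).

Let rl := coxcycle up (iota 1 m).
Let cl := [seq x <- iota m.+1 (n - m) | up x] ++ rev [seq x <- iota m.+1 (n - m) | ~~ up x].

Lemma ar_iota : iota 1 n = iota 1 m ++ iota m.+1 (n - m).
Proof. by rewrite -[in LHS](subnKC (ltnW mn)) iotaD add1n. Qed.

(** In the unimodal cycle the letters beyond m lie at both ends, the down ones first and the up ones
    last; a rotation joins them into the single arc [cl] behind [rl]. *)
Lemma ar_cycle : fcycle (permapp c) (rl ++ cl).
Proof.
move: cyc; rewrite /coxcycle ar_iota !filter_cat rev_cat -!catA.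
by rewrite -(rot_cycle (size (rev [seq x <- iota m.+1 (n - m) | ~~ up x]))) rot_size_cat -!catA.
Qed.

Lemma mem_rl x : (x \in rl) = (0 < x <= m).
Proof. by rewrite mem_cat mem_rev !mem_filter mem_iota add1n ltnS; case: (up x); rewrite ?orbF. Qed.

Lemma mem_cl x : (x \in cl) = (m < x <= n).
Proof.
rewrite mem_cat mem_rev !mem_filter mem_iota addSn subnKC ?(ltnW mn) // ltnS.
by case: (up x); rewrite ?orbF.
Qed.

Lemma uniq_rl : uniq rl.
Proof.
rewrite cat_uniq rev_uniq !filter_uniq ?iota_uniq //= andbT.
by apply/hasPn => x; rewrite mem_rev !mem_filter => /andP[-> _].
Qed.

Lemma uniq_cl : uniq cl.
Proof.
rewrite cat_uniq rev_uniq !filter_uniq ?iota_uniq //= andbT.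
by apply/hasPn => x; rewrite mem_rev !mem_filter => /andP[/negbTE -> _].
Qed.

Lemma uniq_rl_cl : uniq (rl ++ cl).
Proof.
rewrite cat_uniq uniq_rl uniq_cl andbT /=; apply/hasPn => x; rewrite mem_cl mem_rl; lia.
Qed.

Lemma mem_ar v : (v \in ar_m n m) = (v.1 \in rl) && (v.2 \in cl).
Proof.
rewrite mem_rl mem_cl !mem_filter; have -> : (v \in [seq (i, j) | i <- iota 1 n, j <- iota 1 n]) =
    (0 < v.1 <= n) && (0 < v.2 <= n).
  case: v => a b /=; apply/allpairsP/andP => [[[i j] /= [hi hj [-> ->]]]|[ha hb]].
    by move: hi hj; rewrite !mem_iota; lia.
  by exists (a, b); rewrite !mem_iota; split => //=; lia.
by move: (v.1) (v.2) => a b; clear -mn; lia.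
Qed.

(** Every row letter is smaller than every column letter, so an arrow is exactly one step of the
    cycle in one coordinate, and both coordinates run along arcs. *)
Lemma ar_edge_grid : {in ar_m n m &, forall u v, ar_edge c u v =
  gridstep (index u.1 rl, index u.2 cl) (index v.1 rl, index v.2 cl)}.
Proof.
move=> u v; rewrite !mem_ar => /andP[u1 u2] /andP[v1 v2].
have rl0 : 0 < size rl by case: (rl) u1.
have cl0 : 0 < size cl by case: (cl) u2.
have ieq (s : seq nat) x y : x \in s -> y \in s -> (index x s == index y s) = (x == y).
  by move=> xs ys; apply/eqP/eqP => [/(index_inj 0 xs ys)|->].
have r1 : (v.1 == permapp c u.1) = (index v.1 rl == (index u.1 rl).+1).
  exact: fcycle_index ar_cycle uniq_rl_cl cl0 u1 v1.
have r2 : (v.2 == permapp c u.2) = (index v.2 cl == (index u.2 cl).+1).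
  apply: (fcycle_index (t := rl)) => //.
    by rewrite -(rot_cycle (size cl)) rot_size_cat; apply: ar_cycle.
  by rewrite uniq_catC uniq_rl_cl.
rewrite /ar_edge /gridstep /= -r1 -r2 !ieq //.
have lt a b : a \in rl -> b \in cl -> a < b.
  by rewrite mem_rl mem_cl => /andP[_ h1] /andP[h2 _]; apply: leq_ltn_trans h1 h2.
have e1 : (v.2 == permapp c u.2) && (u.1 < permapp c u.2) = (v.2 == permapp c u.2).
  by case: eqP => //= <-; apply: lt.
have e2 : (v.1 == permapp c u.1) && (permapp c u.1 < u.2) = (v.1 == permapp c u.1).
  by case: eqP => //= <-; apply: lt.
by rewrite e1 e2 orbC andbC.
Qed.

Lemma GK_ar w i : GK (ar_m n m) (ar_edge c) w i.+1 = gkpart rl cl (fun x y => w (x, y)) i.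
Proof.
have rl0 : 0 < size rl.
  by have := mem_rl m; rewrite m0 leqnn /=; case: (rl).
have cl0 : 0 < size cl.
  by have := mem_cl n; rewrite mn leqnn /=; case: (cl).
by rewrite /GK !(GK_M_grid uniq_rl uniq_cl mem_ar ar_edge_grid _ _ rl0 cl0).
Qed.

Lemma filter_rl isB : [seq x <- rl | isB x] = rowseq isB up (take m (iota 1 n)).
Proof.
rewrite take_iota (minn_idPl (ltnW mn)) /rl /coxcycle filter_cat filter_rev.
by rewrite -!filter_predI.
Qed.

Lemma filter_cl isB : [seq x <- cl | ~~ isB x] = colseq isB up (drop m (iota 1 n)).
Proof.
rewrite drop_iota add1n /cl filter_cat filter_rev.
by rewrite -!filter_predI.
Qed.

Lemma GK_ar_shape isB w i :
  (forall x y, ~~ (isB x && ~~ isB y) -> w (x, y) = 0) ->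
  GK (ar_m n m) (ar_edge c) w i.+1 = gkshape isB up (iota 1 n) (fun x y => w (x, y)) m i.
Proof.
move=> w0; rewrite GK_ar /gkshape -filter_rl -filter_cl /gkpart.
by rewrite !(gkseq_filter _ _ _ w0).
Qed.

End ARGrid.

(** * Reverse plane partitions as interlacing sequences *)

Lemma nth_le_count s m i : sorted ltn s -> i < size s ->
  (nth 0 s i <= m) = (i < count (fun x => x <= m) s).
Proof.
elim: s i => // x s IH i /= ps; have srt := path_sorted ps.
have [xm|mx] := leqP x m.
  by case: i => [|i] //= lt; rewrite add1n ltnS IH.
have gt y : y \in s -> m < y.
  by move=> ys; apply: ltn_trans mx _; apply: (allP (order_path_min ltn_trans ps)).
have -> : count (fun y => y <= m) s = 0.
  by apply/eqP; rewrite -leqn0 leqNgt -has_count; apply/hasPn => y /gt; rewrite -ltnNge.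
case: i => [_|i lt] /=; first by rewrite leqNgt mx.
by rewrite leqNgt gt // mem_nth.
Qed.

Lemma mem_fer_seq lam p : (p \in fer_seq lam) = in_fer lam p.
Proof.
case: p => i j; rewrite /in_fer /=; apply/allpairsPdep/and3P => [[i' [j' [hi hj [-> ->]]]]|[i0 j0 jl]].
  by move: hi hj; rewrite !mem_iota !add1n !ltnS => /andP[-> _] /andP[-> ->].
exists i, j; rewrite !mem_iota !add1n !ltnS i0 j0 jl; split => //=.
by rewrite -(prednK i0) ltnNge; apply/negP => /(nth_default 0) e; move: jl; rewrite /lam_ e leqNgt j0.
Qed.

Lemma hook11E lam k : k.+1 <= size lam ->
  (forall i, (0 < nth 0 lam i) = (i < k.+1)) -> hook11 lam = nth 0 lam 0 + k.
Proof.
move=> sk pos; rewrite /hook11 /fer_seq /allpairs_dep count_flatten -map_comp sumnE big_map.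
have row i : i \in iota 2 (size lam).-1 ->
    count (fun p : nat * nat => (p.1 == 1) || (p.2 == 1)) [seq (i, j) | j <- iota 1 (lam_ lam i)] =
    (i.-1 < k.+1).
  rewrite mem_iota => i2; rewrite count_map -pos /lam_.
  rewrite (@eq_count _ _ (pred1 1)); last by move=> j /=; rewrite gtn_eqF //; case/andP: i2.
  by rewrite count_uniq_mem ?iota_uniq // mem_iota; case: (nth 0 lam i.-1).
rewrite -(prednK (leq_ltn_trans (leq0n k) sk)) /= big_cons /=.
congr (_ + _).
  by rewrite count_map (@eq_count _ _ xpredT) // count_predT size_iota.
rewrite (eq_big_seq _ row) -[2]/(1 + 1) iotaDl big_map /=.
rewrite -(big_mkcond (fun i => i < k.+1) (fun _ => 1)) sum1_count.
have -> : (size lam).-1 = k + ((size lam).-1 - k) by lia.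
rewrite iotaD count_cat; have -> : count (fun i => i < k.+1) (iota 1 k) = k.
  by rewrite -[RHS](size_iota 1 k); apply/eqP; rewrite -all_count; apply/allP => i; rewrite mem_iota add1n => /andP[].
rewrite -[RHS]addn0; congr (_ + _); apply/eqP; rewrite -leqn0 leqNgt -has_count.
by apply/hasPn => i; rewrite mem_iota; lia.
Qed.

(** That 1 lies in [B] makes the first row as long as [E]; that the maximum lies in [E] makes all
    rows indexed by [B] nonempty. The first row and column then give the hook, hence n. *)
Lemma elementary_bipartitionE lam n B E :
  n = hook11 lam + 1 -> interval_bipartition B E -> elementary B E ->
  same_partition (lamBE B E) lam ->
  [/\ perm_eq (B ++ E) (iota 1 n), lam_ lam 1 = size E &
      forall i, nth 0 lam i = if i < size B then count (fun e => nth 0 B i < e) E else 0].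
Proof.
move=> en [sB sE [i0 [j0 [i0p ij pBE]]]] [B1 ME] same.
have lE i : nth 0 lam i = if i < size B then count (fun e => nth 0 B i < e) E else 0.
  rewrite -same; case: ltnP => h; first by rewrite (nth_map 0).
  by rewrite nth_default ?size_map.
have i01 : i0 = 1.
  by have := perm_mem pBE 1; rewrite mem_cat B1 mem_iota => /esym/andP[h _]; lia.
rewrite {}i01 subn1 in pBE i0p ij *.
have uBE : uniq (B ++ E) by rewrite (perm_uniq pBE) iota_uniq.
have disj x : x \in B -> x \in E -> False.
  by move: uBE; rewrite cat_uniq => /and3P[_ /hasPn h _] xB /h; rewrite xB.
have szBE : size B + size E = j0 by rewrite -size_cat (perm_size pBE) size_iota.
have B0 : nth 0 B 0 = 1.
  case: B {pBE lE szBE ME uBE same disj} B1 sB (perm_mem pBE) => // b B + sB mB.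
  rewrite inE => /predU1P[->//|B1]; have := allP (order_path_min ltn_trans sB) _ B1.
  by have := mB b; rewrite mem_cat mem_head mem_iota /=; lia.
have szB : 0 < size B by case: (B) B1.
have l0 : nth 0 lam 0 = size E.
  rewrite lE szB B0; apply/eqP; rewrite -all_count; apply/allP => e eE.
  have : e \in B ++ E by rewrite mem_cat eE orbT.
  rewrite (perm_mem pBE) mem_iota => /andP[e0 _]; rewrite ltn_neqAle e0 andbT.
  by apply/eqP => e1; apply: (disj e) => //; rewrite -e1.
have pos i : (0 < nth 0 lam i) = (i < size B).
  rewrite lE; have [iB|//] := ltnP i (size B); rewrite -has_count; apply/hasP.
  exists (\max_(x <- B ++ E) x) => //; have nB := mem_nth 0 iB.
  rewrite ltn_neqAle; apply/andP; split; first by apply/eqP => e; apply: (disj _ nB); rewrite e.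
  by apply: (@bigop.leq_bigmax_seq _ _ _ (fun x => x)) => //; rewrite mem_cat nB.
have sz : size B <= size lam.
  rewrite leqNgt; apply/negP => lt; have := pos (size lam).
  by rewrite nth_default // lt.
have hk : hook11 lam = size E + (size B).-1.
  by rewrite -l0; apply: hook11E => [|i]; rewrite (prednK szB).
have <- : j0 = n by rewrite en hk -szBE; lia.
by split.
Qed.

Section Translation.

Variables (lam B E : seq nat) (n : nat).
Hypotheses (sB : sorted ltn B) (sE : sorted ltn E) (pBE : perm_eq (B ++ E) (iota 1 n)).
Hypothesis lam1 : lam_ lam 1 = size E.
Hypothesis lamE : forall i,
  nth 0 lam i = if i < size B then count (fun e => nth 0 B i < e) E else 0.

Let isB : pred nat := fun x => x \in B.
Let cB m := count (fun x => x <= m) B.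
Let cE m := count (fun x => x <= m) E.
Let q := size E.

Lemma uniq_BE : uniq (B ++ E).
Proof. by rewrite (perm_uniq pBE) iota_uniq. Qed.

Lemma mem_BE x : (x \in B) || (x \in E) = (0 < x <= n).
Proof. by rewrite -mem_cat (perm_mem pBE) mem_iota add1n. Qed.

Lemma notin_BE x : x \in B -> x \in E -> False.
Proof. by move: uniq_BE; rewrite cat_uniq => /and3P[_ /hasPn h _] xB /h; rewrite xB. Qed.

Lemma size_BE : size B + q = n.
Proof. by rewrite -size_cat (perm_size pBE) size_iota. Qed.

Lemma cBE m : m <= n -> cB m + cE m = m.
Proof.
move=> mn; rewrite -count_cat (seq.permP pBE) -[in iota 1 n](subnKC mn) iotaD count_cat.
rewrite -[RHS](addn0 m); congr (_ + _).
  by rewrite -[RHS](size_iota 1 m); apply/eqP; rewrite -all_count; apply/allP => i;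
    rewrite mem_iota add1n ltnS => /andP[].
by apply/eqP; rewrite -leqn0 leqNgt -has_count; apply/hasPn => i; rewrite mem_iota; lia.
Qed.

Lemma cBS m : cB m.+1 = cB m + (m.+1 \in B).
Proof.
rewrite -(count_uniq_mem _ (_ : uniq B)); last by move: uniq_BE; rewrite cat_uniq => /and3P[].
rewrite /cB -(count_predUI (fun x => x <= m) (pred1 m.+1) B) [X in _ + X](@eq_count _ _ pred0).
  by rewrite count_pred0 addn0; apply: eq_count => x /=; rewrite leq_eqVlt orbC ltnS.
by move=> x /=; apply/andP => -[h /eqP e]; rewrite e ltnn in h.
Qed.

Lemma cE_le m : cE m <= q.
Proof. exact: count_size. Qed.

Lemma cE_mono m m' : m <= m' -> cE m <= cE m'.
Proof. by move=> mm; apply: sub_count => x /= h; apply: leq_trans h mm. Qed.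

Lemma in_ferE i j : in_fer lam (i, j) =
  [&& 0 < i, i <= size B, 0 < j & cE (nth 0 B i.-1) + j <= q].
Proof.
rewrite /in_fer /lam_ /= lamE; case: i => // i /=.
have [iB|iB] := ltnP i (size B); last by case: j.
have -> : count (fun e => nth 0 B i < e) E = q - cE (nth 0 B i).
  rewrite /q /cE -(count_predC (fun e => e <= nth 0 B i)) addKn.
  by apply: eq_count => x /=; rewrite ltnNge.
by congr (_ && _); have := cE_le (nth 0 B i); lia.
Qed.

(** The boxes of diagonal m lie in the rectangle with [cB m] rows and [q - cE m] columns, one row
    per B letter up to m and one column per E letter beyond m. By [cBE] its far corner is on
    diagonal m too, so it is the maximal box whenever the rectangle is nonempty. *)
Lemma in_fer_diag i j : in_fer lam (i, j) -> let m := i + q - j in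
  [/\ 0 < m, m < n, 0 < i, 0 < j & (j <= q) && ((i <= cB m) && (cE m + j <= q))].
Proof.
rewrite in_ferE => /and4P[i0 ip j0 jl] m; have em : m = i + q - j by []; clearbody m.
have mn : m < n by have := size_BE; lia.
have := cBE (ltnW mn) => eqm; have iB : i.-1 < size B by lia.
have im : i <= cB m.
  rewrite leqNgt; apply/negP => lt.
  have : ~~ (nth 0 B i.-1 <= m) by rewrite (nth_le_count m sB iB) -/(cB m) -leqNgt -ltnS prednK.
  rewrite -ltnNge => /ltnW /cE_mono; lia.
split => //; lia.
Qed.

Lemma diag_in_fer i j m : m <= n -> 0 < i -> 0 < j -> i <= cB m -> cE m + j <= q ->
  in_fer lam (i, j).
Proof.
move=> mn i0 j0 im jm; have iB : i <= size B by apply: leq_trans im (count_size _ _).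
rewrite in_ferE i0 iB j0 /=; apply: leq_trans jm; rewrite leq_add2r; apply: cE_mono.
by rewrite nth_le_count // -/(cB m); lia.
Qed.

Lemma umaxE m : 0 < m < n -> 0 < cB m -> cE m < q -> umax lam m = cB m.
Proof.
move=> mn b0 e0; apply/eqP; rewrite eqn_leq; apply/andP; split.
  apply/bigop.bigmax_leqP_seq => -[i j]; rewrite mem_fer_seq => /in_fer_diag.
  rewrite /diag lam1 /= -/q => -[_ _ _ _ /and3P[_ h _]] /eqP e.
  by rewrite e in h.
have eqm : cB m + cE m = m by apply: cBE; lia.
apply: (@leq_trans (cB m, q - cE m).1) => //.
apply: (@bigop.leq_bigmax_seq _ _ _ (fun p : nat * nat => p.1)).
  by rewrite mem_fer_seq; apply: (@diag_in_fer _ _ m) => //; lia.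
by rewrite /diag lam1 -/q /=; lia.
Qed.

(** From the left, each B letter adds at most one nonzero part; from the right, each E letter does.
    Thus the number of parts is at most either side of the rectangle. *)
Lemma interlacing_vanish mu m t : interlacing isB (iota 1 n) mu -> m <= n ->
  (cB m <= t) || (q <= cE m + t) -> mu m t = 0.
Proof.
move=> [h0 hn h] mn; rewrite size_iota in hn h; case/orP => le.
  elim: m t mn le => [|m IH] t mn le; first exact: h0.
  have := h m; rewrite nth_iota // add1n => /(_ _ mn) hm.
  move: le; rewrite cBS; case Bm : (m.+1 \in B) => /= le.
    case: t le => [|t] le; first by rewrite addn1 in le.
    have := hm t; rewrite [isB _]Bm IH ?(ltnW mn) //; lia.
  have := hm t; rewrite [isB _]Bm [mu m t]IH ?(ltnW mn) //; lia.
move: {2}(n - m) (erefl (n - m)) => d.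
elim: d m t mn le => [|d IH] m t mn le ed; first by have -> : m = n by lia.
have mn' : m < n by lia.
have := h m; rewrite nth_iota // add1n => /(_ _ mn') hm.
have eS := cBE mn'; have e0 := cBE mn; move: eS; rewrite cBS; case Bm : (m.+1 \in B) => /= eS.
  have := hm t; rewrite [isB _]Bm [mu m.+1 t]IH //; lia.
case: t le => [|t] le; first by have := cE_le m.+1; lia.
have := hm t; rewrite [isB _]Bm [mu m.+1 t]IH //; lia.
Qed.

Lemma interlacing_step mu m t : interlacing isB (iota 1 n) mu -> m < n ->
  if m.+1 \in B then mu m.+1 t.+1 <= mu m t <= mu m.+1 t
  else mu m t.+1 <= mu m.+1 t <= mu m t.
Proof.
by move=> [_ _ h] mn; have := h m t; rewrite size_iota nth_iota // add1n; apply.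
Qed.

(** With parts numbered from 0, the maximal box of the diagonal, in row [cB m], receives the largest
    part. *)
Definition diagonal_read (mu : nat -> nat -> nat) i j : nat := mu (i + q - j) (cB (i + q - j) - i).

(** A step down leads to the next diagonal. If the next letter is in [B], the maximal row moves
    along and the part index stays; otherwise the index drops by one. Each case is one of the two
    interlacing inequalities. *)
Lemma diagonal_read_row mu i j : interlacing isB (iota 1 n) mu -> in_fer lam (i.+1, j) -> in_fer lam (i, j) ->
  diagonal_read mu i j <= diagonal_read mu i.+1 j.
Proof.
move=> il /in_fer_diag [_ mn' _ _ /and3P[jq iB' _]] /in_fer_diag [_ mn _ _ /and3P[_ iB _]].
rewrite /diagonal_read; have e : i.+1 + q - j = (i + q - j).+1 by lia.
rewrite e in mn' iB' *; move: (i + q - j) mn mn' iB iB' {e} => m mn mn' iB iB'.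
have := @interlacing_step mu m; move: iB'; rewrite cBS; case Bm : (m.+1 \in B) => /= iB' h.
  by rewrite addn1 subSS; have /andP[] := h (cB m - i) il mn.
have := h (cB m - i.+1) il mn; rewrite (_ : (cB m - i.+1).+1 = cB m - i); last by lia.
by rewrite addn0 => /andP[].
Qed.

Lemma diagonal_read_col mu i j : interlacing isB (iota 1 n) mu -> in_fer lam (i, j.+1) -> in_fer lam (i, j) ->
  diagonal_read mu i j <= diagonal_read mu i j.+1.
Proof.
move=> il /in_fer_diag [m0 mn' _ _ /and3P[jq iB' _]] /in_fer_diag [_ mn _ _ /and3P[_ iB _]].
rewrite /diagonal_read; have e : i + q - j = (i + q - j.+1).+1 by lia.
rewrite e in mn iB *; move: (i + q - j.+1) mn mn' iB iB' {e m0} => m mn mn' iB iB'.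
have := interlacing_step (cB m - i) il mn'; rewrite cBS; case: (m.+1 \in B).
  by rewrite /= addn1 subSn // => /andP[].
by rewrite addn0 => /andP[].
Qed.

Lemma in_fer_le i j i' j' : in_fer lam (i', j') -> 0 < i -> 0 < j -> i <= i' -> j <= j' ->
  in_fer lam (i, j).
Proof.
rewrite !in_ferE => /and4P[_ ip _ jl] i0 j0 ii jj; rewrite i0 j0 (leq_trans ii ip) /=.
apply: leq_trans jl; apply: leq_add => //; apply: cE_mono.
move: ii; rewrite leq_eqVlt => /predU1P[->//|lt].
by apply: ltnW; apply: (sorted_ltn_nth ltn_trans 0 sB); rewrite ?inE; lia.
Qed.

Lemma diagonal_read_mono mu i j i' j' : interlacing isB (iota 1 n) mu ->
  in_fer lam (i, j) -> in_fer lam (i', j') -> i <= i' -> j <= j' ->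
  diagonal_read mu i j <= diagonal_read mu i' j'.
Proof.
move=> il fij fij' ii jj; have /and3P[i0 j0 _] := fij; rewrite /= in i0 j0.
apply: (@leq_trans (diagonal_read mu i' j)).
  elim: i' ii fij' => [|i' IH]; first by rewrite leqn0 => /eqP->.
  rewrite leq_eqVlt => /predU1P[<-//|lt] f'; rewrite ltnS in lt.
  have f1 : in_fer lam (i', j') by apply: (in_fer_le f'); have /and3P[] := f'; rewrite /=; lia.
  apply: leq_trans (IH lt f1) _; apply: diagonal_read_row => //.
    by apply: (in_fer_le f').
  by apply: (in_fer_le f1) => //; lia.
elim: j' jj fij' => [|j' IH]; first by rewrite leqn0 => /eqP->.
rewrite leq_eqVlt => /predU1P[<-//|lt] f'; rewrite ltnS in lt.
have f1 : in_fer lam (i', j') by apply: (in_fer_le f') => //; have /and3P[] := f'; rewrite /=; lia.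
by apply: leq_trans (IH lt f1) _; apply: diagonal_read_col.
Qed.

(** The inverse of [diagonal_read]: part t is found t steps up the diagonal from its maximal box,
    and parts beyond the rectangle are zero. *)
Definition diagonals (g : nat -> nat -> nat) m t : nat :=
  if (t < cB m) && (cE m + t < q) then g (cB m - t) (q - cE m - t) else 0.

Lemma diagonals_interlacing g :
  (forall i j i' j', in_fer lam (i, j) -> in_fer lam (i', j') -> i <= i' -> j <= j' -> g i j <= g i' j') ->
  interlacing isB (iota 1 n) (diagonals g).
Proof.
move=> mono; have bn := cBE (leqnn n); have size_b := size_BE.
have cBn : cB n <= size B by apply: count_size.
have cEn := cE_le n; have b0 := cBE (leq0n n).
have fer m t : m <= n -> t < cB m -> cE m + t < q -> in_fer lam (cB m - t, q - cE m - t).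
  by move=> mn h1 h2; apply: (@diag_in_fer _ _ m) => //; lia.
split=> [t|t|m t]; rewrite ?size_iota.
- by rewrite /diagonals (_ : cB 0 = 0) //; lia.
- by rewrite /diagonals ifF //; apply/negbTE; lia.
move=> mn; rewrite nth_iota // add1n /diagonals; have := @fer m; have := @fer m.+1.
have e0 := cBE (ltnW mn); have := cBE mn.
rewrite cBS (_ : isB m.+1 = (m.+1 \in B)) //; case: (m.+1 \in B) => e1 f1 f0.
  rewrite addn1 in e1 f1 *; have eE : cE m.+1 = cE m by lia.
  rewrite eE in f1 *; apply/andP; split; case: ifP => // /andP[h1 h2].
    rewrite ifT; last by lia.
    apply: mono; [apply: f1|apply: f0| |]; lia.
  rewrite ifT; last by lia.
  apply: mono; [apply: f0|apply: f1| |]; lia.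
rewrite addn0 in e1 f1 *; have eE : cE m.+1 = (cE m).+1 by lia.
rewrite eE in f1 *; apply/andP; split; case: ifP => // /andP[h1 h2].
  rewrite ifT; last by lia.
  apply: mono; [apply: f0|apply: f1| |]; lia.
rewrite ifT; last by lia.
apply: mono; [apply: f1|apply: f0| |]; lia.
Qed.

Lemma fbar_box (f : filling lam) (bx : box lam) :
  fbar B E f (nth 0 B (val bx).1.-1, nth 0 E (q - (val bx).2)) = f bx.
Proof.
case: bx => -[i j] hb; have := hb; rewrite in_ferE => /and4P[i0 iB j0 jl].
have iB' : i.-1 < size B by lia.
have jE : q - j < size E by rewrite -/q; lia.
move: uniq_BE; rewrite cat_uniq => /and3P[uB _ uE].
rewrite /fbar /= !mem_nth // !index_uniq // -/q prednK // subKn; last by lia.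
by rewrite insubT; congr f; apply: val_inj.
Qed.

Lemma fbar_make (F : nat -> nat -> nat) x y : x \in B -> y \in E -> x < y ->
  fbar B E (fun bx : box lam => F (nth 0 B (val bx).1.-1) (nth 0 E (q - (val bx).2))) (x, y) = F x y.
Proof.
move=> xB yE xy; rewrite /fbar /= xB yE /=.
have iB : index x B < size B by rewrite index_mem.
have iE : index y E < size E by rewrite index_mem.
have h : in_fer lam ((index x B).+1, size E - index y E).
  rewrite in_ferE /= iB nth_index // subn_gt0 iE /=.
  suff : cE x <= index y E by rewrite /q; lia.
  by rewrite leqNgt -(nth_le_count x sE iE) nth_index // -ltnNge.
by rewrite insubT /= nth_index // subKn ?nth_index // ltnW.
Qed.

Section WithCoxeter.

Variables (c : {perm 'I_n}) (up : pred nat).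
Hypothesis cyc : fcycle (permapp c) (coxcycle up (iota 1 n)).

Let shape_of (f : filling lam) := gkshape isB up (iota 1 n) (fun x y => fbar B E f (x, y)).

Lemma rskE (f : filling lam) (bx : box lam) :
  rsk c B E f bx = diagonal_read (shape_of f) (val bx).1 (val bx).2.
Proof.
case: bx => -[i j] hb; rewrite /rsk /= /diagonal_read.
have [m0 mn i0 j0 /and3P[jq iB jE]] := in_fer_diag hb.
have -> : diag lam (i, j) = i + q - j by rewrite /diag lam1.
rewrite umaxE ?m0 //; try by lia.
rewrite addn1 (GK_ar_shape (isB := isB) cyc m0 mn) // => x y.
rewrite /fbar /= /isB; case xB : (x \in B) => //=.
by rewrite negbK => yB; case: ifP => // yE; case: (notin_BE yB yE).
Qed.

Lemma shape_of_interlacing f : interlacing isB (iota 1 n) (shape_of f).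
Proof. exact: gkshape_interlacing. Qed.

Lemma rsk_rpp (f : filling lam) : is_rpp (rsk c B E f).
Proof.
move=> x y /andP[h1 h2]; rewrite !rskE; apply: diagonal_read_mono => //.
- exact: shape_of_interlacing.
- by rewrite -surjective_pairing; apply: (valP x).
- by rewrite -surjective_pairing; apply: (valP y).
Qed.

(** The parts not read by any box vanish by [interlacing_vanish], so the output filling determines
    the whole interlacing sequence. This transfers injectivity from sequences to fillings. *)
Lemma shape_of_diagonals f : exists g : nat -> nat -> nat,
  (forall bx : box lam, g (val bx).1 (val bx).2 = rsk c B E f bx) /\
  forall m t, m <= n -> shape_of f m t = diagonals g m t.
Proof.
exists (diagonal_read (shape_of f)); split=> [bx|m t mn]; first by rewrite rskE.
rewrite /diagonals; case: ifP => [/andP[h1 h2]|/negbT h]; last first.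
  apply: interlacing_vanish mn _; first exact: shape_of_interlacing.
  by move: h; rewrite negb_and -!leqNgt.
have eqm := cBE mn; rewrite /diagonal_read.
have -> : cB m - t + q - (q - cE m - t) = m by lia.
by congr (shape_of f _ _); lia.
Qed.

Lemma eq_diagonals g g' m t : m <= n ->
  (forall i j, in_fer lam (i, j) -> g i j = g' i j) -> diagonals g m t = diagonals g' m t.
Proof.
move=> mn e; rewrite /diagonals; case: ifP => // /andP[h1 h2]; apply: e.
by apply: (@diag_in_fer _ _ m) => //; have := cBE mn; lia.
Qed.

Lemma rsk_inj : injective (@rsk lam n c B E).
Proof.
move=> f f' ef; have [_ inj] := gkshape_bijective isB up (iota_uniq 1 n).
have [g [eg hg]] := shape_of_diagonals f; have [g' [eg' hg']] := shape_of_diagonals f'.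
have efb x y : x \in B -> y \in E -> x < y -> fbar B E f (x, y) = fbar B E f' (x, y).
  move=> xB yE xy; apply: (inj (fun x y => fbar B E f (x, y)) (fun x y => fbar B E f' (x, y))) => //.
  - move=> m i; rewrite size_iota => mn.
    rewrite -/(shape_of f m i) -/(shape_of f' m i) hg // hg' //; apply: eq_diagonals => // i' j' h.
    by have := eg (Sub (i', j') h); have := eg' (Sub (i', j') h); rewrite /= => -> ->; rewrite ef.
  - by apply/negP => yB; apply: (notin_BE yB yE).
  have := mem_BE x; have := mem_BE y; rewrite xB yE orbT => /esym yn /esym xn.
  (* The cut directly after x separates it from the larger letter y. *)
  by exists x; rewrite take_iota drop_iota !mem_iota; lia.
apply: functional_extensionality => -[[i j] hb]; rewrite -!fbar_box.
have := hb; rewrite in_ferE => /and4P[i0 iB j0 jl] /=.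
have iB' : i.-1 < size B by lia.
have jE : q - j < size E by rewrite -/q; lia.
apply: efb; rewrite ?mem_nth // ltnNge (nth_le_count _ sE jE).
by rewrite -/(cE _); lia.
Qed.

Lemma rsk_surj (g : filling lam) : is_rpp g -> exists f, rsk c B E f = g.
Proof.
move=> rg; pose g0 i j := if insub (i, j) : option (box lam) is Some bx then g bx else 0.
have g0E (bx : box lam) : g0 (val bx).1 (val bx).2 = g bx.
  by rewrite /g0 -surjective_pairing valK.
have il : interlacing isB (iota 1 n) (diagonals g0).
  apply: diagonals_interlacing => i j i' j' h h' ii jj.
  have := g0E (Sub (i, j) h); have := g0E (Sub (i', j') h'); rewrite /= => -> ->.
  by apply: rg; rewrite /boxle /= ii jj.
have [surj _] := gkshape_bijective isB up (iota_uniq 1 n).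
have [F eF] := surj _ il.
exists (fun bx => F (nth 0 B (val bx).1.-1) (nth 0 E (q - (val bx).2))).
apply: functional_extensionality => bx; rewrite rskE -g0E.
case: bx => -[i j] hb /=; have [m0 mn i0 j0 /and3P[jq iB jE]] := in_fer_diag hb.
rewrite /diagonal_read /shape_of; move em : (i + q - j) m0 mn iB jE => m m0 mn iB jE.
(* At cut m the shape sees only pairs with x <= m < y, and on these the filling pulled back from [F]
   reproduces [F]. *)
rewrite (@eq_gkshape _ _ _ _ F) => [|x y xB yB].
  rewrite eF ?size_iota 1?ltnW // /diagonals; have := cBE (ltnW mn) => eqm.
  rewrite ifT; last by lia.
  by congr g0; lia.
rewrite take_iota drop_iota !mem_iota => xm ym; apply: fbar_make => //; last by lia.
have := mem_BE y; rewrite (_ : (y \in B) = false) ?orFb => [->|]; [by lia | exact: negbTE yB].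
Qed.

End WithCoxeter.

End Translation.

Theorem theorem4p1 (lam : seq nat) (n : nat) (c : {perm 'I_n}) (B E : seq nat) :
  is_partition lam -> part_nonzero lam -> n = hook11 lam + 1 -> coxeter c ->
  interval_bipartition B E -> elementary B E -> same_partition (lamBE B E) lam ->
  [/\ (forall f : filling lam, is_rpp (rsk c B E f)),
      injective (@rsk lam n c B E) &
      (forall g : filling lam, is_rpp g -> exists f, rsk c B E f = g)].
Proof.
move=> _ _ en cc iBE eBE same; have [sB sE _] := iBE.
have [pBE lam1 lamE] := elementary_bipartitionE en iBE eBE same.
have n0 : 0 < n by rewrite en addn1.
have [up cyc] := coxeter_permapp n0 cc.
split=> [f||g rg]; first exact: (rsk_rpp sB sE pBE lam1 lamE cyc).
  exact: (rsk_inj sB sE pBE lam1 lamE cyc).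
exact: (rsk_surj sB sE pBE lam1 lamE cyc).
Qed.
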